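(* Let $A_\Gamma$ be an Artin group of infinite type, with Artin monoid $M=A_\Gamma^+$ viewed as a submonoid of $A_\Gamma$. The map $f$ from the vertices of $\mathrm{Cay}(A_\Gamma,M)$ to the vertices of the coned off Deligne complex $C\mathcal{D}_\Gamma$ given by $f(g)=v_g$ for $g\in A_\Gamma$ is a quasi-isometry. In particular, $\mathrm{Cay}(A_\Gamma,M)$ and $C\mathcal{D}_\Gamma$ are quasi-isometric.
   Context: Artin group: let $\Gamma$ be a finite simple graph with vertex set $X=\{x_1,\dots,x_n\}$ and edges labelled by integers $m_{i,j}=m_{j,i}\ge2$. Then $A_\Gamma=\langle X\mid \underbrace{x_ix_jx_i\cdots}_{m_{i,j}}=\underbrace{x_jx_ix_j\cdots}_{m_{i,j}}$ for every edge $\{x_i,x_j\}\rangle$. The Coxeter group $W_\Gamma$ is obtained by adding the relations $x_i^2=e$. $A_\Gamma$ is of spherical type if $W_\Gamma$ is finite, and of infinite type otherwise. The monoid $A_\Gamma^+$ with the same presentation is identified (theorem of Paris) with the submonoid $M$ of $A_\Gamma$ of elements represented by positive words in $X$. For $T\subseteq X$, the special subgroup $A_T$ is the subgroup generated by $T$; by a theorem of van der Lek it is the Artin group of the full labelled subgraph of $\Gamma$ spanned by $T$. $A_T$ is of spherical type if the corresponding Coxeter group is finite; $T=\emptyset$ is allowed, with $gA_\emptyset=\{g\}$. Monoid Cayley graph $\mathrm{Cay}(A_\Gamma,M)$: vertices are the elements of $A_\Gamma$; $g,h$ are joined by an edge whenever $h=gm$ or $g=hm$ for some $m\in M$; path metric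 with edges of length 1. Deligne complex $\mathcal{D}^{\Delta}_\Gamma$: the simplicial complex that is the geometric realization of the poset, ordered by inclusion, of all cosets $gA_T$ with $g\in A_\Gamma$ and $A_T$ a special subgroup of spherical type. The group $A_\Gamma$ acts on it by left multiplication of cosets. Monoid Deligne complex $\mathcal{D}^{\Delta+}_\Gamma$: the subcomplex that is the geometric realization of the subposet of cosets of the form $mA_T$ with $m\in M$ (and $A_T$ of spherical type). For $g\in A_\Gamma$, $g\mathcal{D}^{\Delta+}_\Gamma$ is its translate by $g$. Coned off Deligne complex $C\mathcal{D}_\Gamma$: the simplicial complex obtained from $\mathcal{D}^{\Delta}_\Gamma$ by adding, for every $g\in A_\Gamma$, a new vertex $v_g$, an edge between $v_g$ and every vertex of $g\mathcal{D}^{\Delta+}_\Gamma$, and a $(p+1)$-simplex $v_g*\sigma$ for every $p$-simplex $\sigma$ of $g\mathcal{D}^{\Delta+}_\Gamma$. It is given the piecewise Euclidean (length) metric in which every simplex is a standard Euclidean simplex with all edges of length 1. *)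

(* Defs.v *)
From HB Require Import structures.
From mathcomp Require Import all_boot all_order all_algebra.
From mathcomp Require Import boolp classical_sets functions cardinality fsbigop.
From mathcomp Require Import reals constructive_ereal ereal.

Set Implicit Arguments.
Unset Strict Implicit.
Unset Printing Implicit Defensive.

Import Order.TTheory GRing.Theory Num.Theory.
Local Open Scope classical_set_scope.

(* The letter (x, false) stands for x and (x, true) for its formal inverse. *)
Definition word (X : Type) : Type := seq (X * bool).

Definition word_inv (X : Type) (w : word X) : word X :=
  rev [seq (a.1, ~~ a.2) | a <- w].

(* Equality in the group presented by < X | u = v for all u, v with r u v >. *)
Inductive presented_eq (X : Type) (r : word X -> word X -> Prop) :
    word X -> word X -> Prop :=
| presented_refl u : presented_eq r u u
| presented_sym u v : presented_eq r u v -> presented_eq r v u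
| presented_trans u v w :
    presented_eq r u v -> presented_eq r v w -> presented_eq r u w
| presented_cancel a b x e :
    presented_eq r (a ++ [:: (x, e); (x, ~~ e)] ++ b) (a ++ b)
| presented_relator a b u v :
    r u v -> presented_eq r (a ++ u ++ b) (a ++ v ++ b).

Section PresentedGroup.
Local Open Scope quotient_scope.
Variables (X : choiceType) (r : word X -> word X -> Prop).
Implicit Types u v w : word X.

Definition presented_rel : rel (word X) := fun u v => `[< presented_eq r u v >].

Lemma presented_rel_class : equiv_class_of presented_rel.
Proof.
split=> [u|u v|v u w]; first by apply/asboolP; exact: presented_refl.
- by apply/asboolP/asboolP => /presented_sym.
- by move=> /asboolP uv /asboolP vw; apply/asboolP; exact: presented_trans uv vw.
Qed.

Canonical presented_equiv := EquivRelPack presented_rel_class.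

Definition presented_group : Type := {eq_quot presented_equiv}.

HB.instance Definition _ := Choice.on presented_group.

Definition presented_pi (w : word X) : presented_group :=
  \pi_({eq_quot presented_equiv}) w.

Definition presented_repr (g : presented_group) : word X :=
  repr (g : {eq_quot presented_equiv}).

Lemma presented_reprK g : presented_pi (presented_repr g) = g.
Proof. exact: reprK. Qed.

Lemma presented_piP u v : presented_pi u = presented_pi v <-> presented_eq r u v.
Proof.
split=> [/eqmodP /asboolP //|uv]; apply/eqmodP; exact/asboolP.
Qed.

Lemma presented_eq_ctx a b u v :
  presented_eq r u v -> presented_eq r (a ++ u ++ b) (a ++ v ++ b).
Proof.
elim=> {u v} [u|u v _ /presented_sym //|u v w _ + _|c d x e|c d u v ruv].
- exact: presented_refl.
- exact: presented_trans.
- by have := presented_cancel r (a ++ c) (d ++ b) x e; rewrite -!catA.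
- by have := presented_relator (a ++ c) (d ++ b) ruv; rewrite -!catA.
Qed.

Lemma presented_eq_cat u u' v v' :
  presented_eq r u u' -> presented_eq r v v' -> presented_eq r (u ++ v) (u' ++ v').
Proof.
move=> /(presented_eq_ctx [::] v) /= uu' /(presented_eq_ctx u' [::]).
rewrite !cats0; exact: presented_trans uu'.
Qed.

Lemma word_invK : involutive (@word_inv X).
Proof.
move=> w; rewrite /word_inv map_rev revK -map_comp -[RHS]map_id.
by apply: eq_map => -[x e] /=; rewrite negbK.
Qed.

Lemma presented_eq_catV w : presented_eq r (w ++ word_inv w) [::].
Proof.
elim: w => [|[x e] w IHw] /=; first exact: presented_refl.
rewrite /word_inv /= rev_cons -/(word_inv w) -cats1.
apply: presented_trans (presented_cancel r [::] [::] x e).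
by have := presented_eq_ctx [:: (x, e)] [:: (x, ~~ e)] IHw; rewrite -catA.
Qed.

Definition presented_one : presented_group := presented_pi [::].

Definition presented_mul (g h : presented_group) : presented_group :=
  presented_pi (presented_repr g ++ presented_repr h).

Definition presented_inv (g : presented_group) : presented_group :=
  presented_pi (word_inv (presented_repr g)).

Lemma presented_repr_pi w : presented_eq r (presented_repr (presented_pi w)) w.
Proof. by apply/presented_piP; rewrite presented_reprK. Qed.

Lemma presented_mulA : associative presented_mul.
Proof.
move=> f g h; apply/presented_piP.
have e1 := presented_repr_pi (presented_repr g ++ presented_repr h).
have e2 := presented_repr_pi (presented_repr f ++ presented_repr g).
apply: presented_trans (presented_eq_cat (presented_refl r _) e1) _.
rewrite catA; apply: presented_sym.
exact: presented_eq_cat e2 (presented_refl r _).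
Qed.

Lemma presented_mul1 : left_id presented_one presented_mul.
Proof.
move=> g; rewrite -[RHS]presented_reprK; apply/presented_piP.
exact: presented_eq_cat (presented_repr_pi [::]) (presented_refl r _).
Qed.

Lemma presented_mulr1 : right_id presented_one presented_mul.
Proof.
move=> g; rewrite -[RHS]presented_reprK; apply/presented_piP.
have := presented_eq_cat (presented_refl r (presented_repr g))
          (presented_repr_pi [::]).
by rewrite cats0.
Qed.

Lemma presented_mulV : right_inverse presented_one presented_inv presented_mul.
Proof.
move=> g; apply/presented_piP.
apply: presented_trans (presented_eq_catV (presented_repr g)).
exact: presented_eq_cat (presented_refl r _) (presented_repr_pi _).
Qed.

Lemma presented_mulVl : left_inverse presented_one presented_inv presented_mul.
Proof.
move=> g; apply/presented_piP.
have := presented_eq_catV (word_inv (presented_repr g)).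
rewrite word_invK; apply: presented_trans.
exact: presented_eq_cat (presented_repr_pi _) (presented_refl r _).
Qed.

HB.instance Definition _ := isGroup.Build presented_group
  presented_mulA presented_mul1 presented_mulr1 presented_mulVl presented_mulV.

Definition presented_gen (x : X) : presented_group := presented_pi [:: (x, false)].

End PresentedGroup.

(* A finite simple graph with labels at least 2 on its edges; the values of
   [label] off the edges are irrelevant. *)
Record labelled_graph := LabelledGraph {
  vertex : finType;
  edge : rel vertex;
  label : vertex -> vertex -> nat;
  edge_sym : symmetric edge;
  edge_irrefl : irreflexive edge;
  label_sym : forall x y, edge x y -> label x y = label y x;
  label_ge2 : forall x y, edge x y -> 2 <= label x y
}.

Section FullSubgraph.
Variables (Gamma : labelled_graph) (T : {set vertex Gamma}).

Let sub_vertex : finType := {x : vertex Gamma | x \in T}.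
Let sub_edge : rel sub_vertex := fun x y => edge (val x) (val y).
Let sub_label (x y : sub_vertex) := label (val x) (val y).

Let sub_edge_sym : symmetric sub_edge.
Proof. by move=> x y; exact: edge_sym. Qed.

Let sub_edge_irrefl : irreflexive sub_edge.
Proof. by move=> x; exact: edge_irrefl. Qed.

Let sub_label_sym x y : sub_edge x y -> sub_label x y = sub_label y x.
Proof. exact: label_sym. Qed.

Let sub_label_ge2 x y : sub_edge x y -> 2 <= sub_label x y.
Proof. exact: label_ge2. Qed.

Definition full_subgraph : labelled_graph :=
  LabelledGraph sub_edge_sym sub_edge_irrefl sub_label_sym sub_label_ge2.

End FullSubgraph.

Fixpoint alternating (X : Type) (n : nat) (x y : X) : word X :=
  if n is n'.+1 then (x, false) :: alternating n' y x else [::].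

Section ArtinGroup.
Local Open Scope group_scope.
Variable Gamma : labelled_graph.
Local Notation X := (vertex Gamma).

Definition artin_relator (u v : word X) : Prop :=
  exists x y : X, [/\ edge x y,
    u = alternating (label x y) x y & v = alternating (label x y) y x].

Definition coxeter_relator (u v : word X) : Prop :=
  artin_relator u v \/
  exists x : X, u = [:: (x, false); (x, false)] /\ v = [::].

Definition artin_group : groupType := presented_group artin_relator.

Definition artin_gen (x : X) : artin_group := presented_gen artin_relator x.

Definition coxeter_group : groupType := presented_group coxeter_relator.

Definition spherical_type : Prop := finite_set [set: coxeter_group].

Definition infinite_type : Prop := ~ spherical_type.

Definition artin_monoid : set artin_group :=
  [set m | exists w : seq X, m = \big[*%g/1]_(x <- w) artin_gen x].

End ArtinGroup.

Section DeligneCosets.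
Local Open Scope group_scope.
Variable Gamma : labelled_graph.
Local Notation X := (vertex Gamma).
Local Notation A := (artin_group Gamma).
Local Notation M := (@artin_monoid Gamma).

Definition is_subgroup (H : set A) : Prop :=
  [/\ H 1, forall g h, H g -> H h -> H (g * h) & forall g, H g -> H g^-1].

Definition special_subgroup (T : {set X}) : set A :=
  smallest is_subgroup (@artin_gen Gamma @` [set` T]).

Definition left_coset (g : A) (S : set A) : set A := [set g * a | a in S].

Definition spherical_cosets (P : set A) : set (set A) :=
  [set C | exists g (T : {set X}),
    [/\ P g, spherical_type (full_subgraph T)
      & C = left_coset g (special_subgroup T)]].

Definition deligne_cosets : set (set A) := spherical_cosets [set: A].

Definition monoid_deligne_cosets : set (set A) := spherical_cosets M.

Definition cayley_edge (g h : A) : Prop :=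
  exists2 m : A, M m & h = g * m \/ g = h * m.

End DeligneCosets.

(* V may have elements that are not vertices: a vertex is a v such that
   [set v] is a simplex. *)
Record simplicial_complex (V : Type) := SimplicialComplex {
  simplices :> set (set V);
  simplex_finite : forall s, simplices s -> finite_set s;
  simplex_nonempty : forall s, simplices s -> s !=set0;
  simplex_face : forall s t, simplices s -> t `<=` s -> t !=set0 -> simplices t
}.

Definition vertices (V : Type) (K : simplicial_complex V) : set V :=
  [set v | simplices K [set v]].

Section OrderComplex.
Variables (T : Type) (P : set (set T)).

Definition chains : set (set (set T)) :=
  [set s | [/\ finite_set s, s !=set0, s `<=` P
             & forall C D, s C -> s D -> C `<=` D \/ D `<=` C]].

Let chain_finite s : chains s -> finite_set s.
Proof. by case. Qed.

Let chain_nonempty s : chains s -> s !=set0.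
Proof. by case. Qed.

Let chain_face s t : chains s -> t `<=` s -> t !=set0 -> chains t.
Proof.
move=> [fs _ sP sC] ts t0; split=> //; first exact: sub_finite_set fs.
- exact: subset_trans sP.
- by move=> C D /ts sCC /ts sD; exact: sC.
Qed.

Definition order_complex : simplicial_complex (set T) :=
  SimplicialComplex chain_finite chain_nonempty chain_face.

End OrderComplex.

Section ImageComplex.
Variables (V W : Type) (f : V -> W) (K : simplicial_complex V).

Let simplices_image : set (set W) := [set f @` s | s in K].

Let image_finite s : simplices_image s -> finite_set s.
Proof. by case=> s' /simplex_finite fs' <-; exact: finite_image. Qed.

Let image_nonempty s : simplices_image s -> s !=set0.
Proof. by case=> s' /simplex_nonempty [v sv] <-; exists (f v), v. Qed.

Let image_face s t :
  simplices_image s -> t `<=` s -> t !=set0 -> simplices_image t.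
Proof.
case=> s' Ks' <- ts [w tw]; exists (s' `&` f @^-1` t).
  apply: (simplex_face Ks') => [v []//|].
  by have [v sv fv] := ts _ tw; exists v; split=> //=; rewrite fv.
apply/seteqP; split=> [_ [v [_ tv] <-]//|y ty].
by have [v sv fv] := ts _ ty; exists v => //; split=> //=; rewrite fv.
Qed.

Definition image_complex : simplicial_complex W :=
  SimplicialComplex image_finite image_nonempty image_face.

End ImageComplex.

Section GraphComplex.
Variables (V : Type) (e : V -> V -> Prop).

Let graph_simplices : set (set V) :=
  [set s | (exists v, s = [set v]) \/ exists v w, e v w /\ s = [set v; w]].

Let graph_finite s : graph_simplices s -> finite_set s.
Proof.
case=> [[v ->]|[v [w [_ ->]]]]; first exact: finite_set1.
by rewrite finite_setU; split; exact: finite_set1.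
Qed.

Let graph_nonempty s : graph_simplices s -> s !=set0.
Proof. by case=> [[v ->]|[v [w [_ ->]]]]; exists v; [|left]. Qed.

Let graph_face s t :
  graph_simplices s -> t `<=` s -> t !=set0 -> graph_simplices t.
Proof.
case=> [[v ->]|[v [w [evw ->]]]] ts [x tx].
  left; exists v; apply/seteqP; split=> // _ ->.
  by have <- := ts _ tx.
have [tv|tv] := pselect (t v); have [tw|tw] := pselect (t w).
- right; exists v, w; split=> //; apply/seteqP; split=> // _ [->|->] //.
- left; exists v; apply/seteqP; split=> [y ty|_ -> //].
  by case: (ts _ ty) => // yw; rewrite yw in ty.
- left; exists w; apply/seteqP; split=> [y ty|_ -> //].
  by case: (ts _ ty) => // yv; rewrite yv in ty.
- by case: (ts _ tx) => xE; rewrite xE in tx.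
Qed.

Definition graph_complex : simplicial_complex V :=
  SimplicialComplex graph_finite graph_nonempty graph_face.

End GraphComplex.

(* For each i : I, a new vertex [inr i] is added to K, together with the
   simplices [inr i] * s for s in the subcomplex L i. *)
Section ConeOff.
Variables (V I : Type) (K : simplicial_complex V).
Variables (L : I -> simplicial_complex V) (LK : forall i, L i `<=` K).

Let cone_simplices : set (set (V + I)) :=
  [set s | [\/ exists2 s', simplices K s' & s = inl @` s',
             exists i, s = [set inr i]
           | exists i, exists2 s', simplices (L i) s' & s = inr i |` inl @` s']].

Let cone_finite s : cone_simplices s -> finite_set s.
Proof.
case=> [[s' /simplex_finite fs' ->]|[i ->]|[i [s' /simplex_finite fs' ->]]].
- exact: finite_image.
- exact: finite_set1.
- by rewrite finite_setU; split; [exact: finite_set1|exact: finite_image].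
Qed.

Let cone_nonempty s : cone_simplices s -> s !=set0.
Proof.
case=> [[s' /simplex_nonempty [v sv] ->]|[i ->]|[i [s' _ ->]]].
- by exists (inl v), v.
- by exists (inr i).
- by exists (inr i); left.
Qed.

Let cone_face s t :
  cone_simplices s -> t `<=` s -> t !=set0 -> cone_simplices t.
Proof.
have inl_face (K' : simplicial_complex V) s' : simplices K' s' ->
    t `<=` inl @` s' -> t !=set0 -> exists2 t', simplices K' t' & t = inl @` t'.
  move=> Ks' ts t0.
  have /= := @simplex_face _ (@image_complex _ (V + I)%type inl K') _ _ _ ts t0.
  by case; [exists s'|move=> t' Kt' <-; exists t'].
case=> [[s' Ks' ->]|[i ->]|[i [s' Ls' ->]]] ts t0.
- by constructor 1; exact: inl_face ts t0.
- constructor 2; exists i; apply/seteqP; split=> // _ ->.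
  by have [x tx] := t0; have <- := ts _ tx.
- have [ti|ti] := pselect (t (inr i)).
    pose t' := [set v | t (inl v)].
    have tE : t = inr i |` inl @` t'.
      apply/seteqP; split=> [x tx|x [->//|[v tv <-]//]].
      by case: (ts _ tx) => [->|[v _ vx]]; [left|right; exists v; rewrite /t' /= ?vx].
    have [t'0|t'0] := pselect (t' !=set0).
      constructor 3; exists i; exists t' => //.
      apply: (simplex_face Ls') => // v /ts [//|[v' s'v' [<-]//]].
    constructor 2; exists i; rewrite tE; apply/seteqP; split=> [x|x ->].
      by case=> // -[v tv _]; case: t'0; exists v.
    by left.
  constructor 1; have [t' Lt' ->] : exists2 t', simplices (L i) t' & t = inl @` t'.
    by apply: inl_face Ls' _ t0 => x tx; case: (ts _ tx) => // xi; rewrite xi in tx.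
  by exists t' => //; exact: LK Lt'.
Qed.

Definition cone_off : simplicial_complex (V + I) :=
  SimplicialComplex cone_finite cone_nonempty cone_face.

End ConeOff.

Section ArtinComplexes.
Variable Gamma : labelled_graph.
Local Notation A := (artin_group Gamma).

(* The condition on edges is satisfied by g = h, which contributes no
   1-simplex: [set g; g] is the vertex g. *)
Definition monoid_cayley : simplicial_complex A :=
  graph_complex (@cayley_edge Gamma).

Definition deligne : simplicial_complex (set A) :=
  order_complex (@deligne_cosets Gamma).

Definition monoid_deligne : simplicial_complex (set A) :=
  order_complex (@monoid_deligne_cosets Gamma).

Definition monoid_deligne_translate (g : A) : simplicial_complex (set A) :=
  image_complex (left_coset g) monoid_deligne.

Lemma monoid_deligne_translate_sub g : monoid_deligne_translate g `<=` deligne.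
Proof.
move=> _ [s [fs [C sC] sP schain] <-]; split.
- exact: finite_image.
- by exists (left_coset g C), C.
- move=> _ [D /sP [h [T [_ Tsph ->]]] <-]; exists (g * h)%g, T; split=> //.
  rewrite /left_coset; apply/seteqP; split=> [_ [_ [a Ta <-] <-]|_ [a Ta <-]].
    by exists a; rewrite // mulgA.
  by exists (h * a)%g; [exists a|rewrite mulgA].
- move=> _ _ [D sD <-] [E sE <-].
  by have [DE|ED] := schain _ _ sD sE; [left|right]; exact: image_subset.
Qed.

Definition coned_deligne : simplicial_complex (set A + A) :=
  cone_off monoid_deligne_translate_sub.

Definition cone_vertex (g : A) : set A + A := inr g.

End ArtinComplexes.

Section Realization.
Local Open Scope ring_scope.
Variables (R : realType) (V : choiceType) (K : simplicial_complex V).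
Implicit Types (x y : V -> R) (v w : V).

Definition vertex_support x : set V := [set v | x v != 0].

(* Points are given by their barycentric coordinates. *)
Definition realization : set (V -> R) :=
  [set x | [/\ forall v, 0 <= x v, simplices K (vertex_support x)
             & \sum_(v \in [set: V]) x v = 1]].

Definition in_common_simplex x y : Prop :=
  exists s, [/\ simplices K s, vertex_support x `<=` s & vertex_support y `<=` s].

(* The Euclidean metric on barycentric coordinates gives the edges of the
   standard simplex length sqrt 2; the factor 1/2 normalizes it to 1. *)
Definition simplex_dist x y : R :=
  Num.sqrt (2^-1 * \sum_(v \in [set: V]) (x v - y v) ^+ 2).

Definition is_string (n : nat) (c : nat -> V -> R) : Prop :=
  (forall i, (i <= n)%N -> realization (c i)) /\
  (forall i, (i < n)%N -> in_common_simplex (c i) (c i.+1)).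

Definition string_length (n : nat) (c : nat -> V -> R) : R :=
  \sum_(0 <= i < n) simplex_dist (c i) (c i.+1).

(* The length pseudometric of a piecewise Euclidean complex: the infimum of
   the lengths of the strings, i.e. of the paths that are concatenations of
   straight segments, each inside a simplex. It is +oo between points that no
   such path joins. *)
Definition length_dist x y : \bar R :=
  ereal_inf [set l | exists n (c : nat -> V -> R),
    [/\ is_string n c, c 0%N = x, c n = y & l = (string_length n c)%:E]].

Definition vertex_point v : V -> R := fun w => (w == v)%:R.

Definition vertex_dist v w : \bar R :=
  length_dist (vertex_point v) (vertex_point w).

End Realization.

Arguments realization R {V} K.
Arguments length_dist R {V} K.
Arguments vertex_dist R {V} K.

Section QuasiIsometry.
Local Open Scope ereal_scope.
Variables (R : realType) (T U : Type).
Variables (D : set T) (d : T -> T -> \bar R) (E : set U) (e : U -> U -> \bar R).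

Definition quasi_isometry (f : T -> U) : Prop :=
  (forall x, D x -> E (f x)) /\
  exists k c : R, [/\ (1 <= k)%R, (0 <= c)%R,
    forall x y, D x -> D y ->
      (k^-1)%:E * d x y - c%:E <= e (f x) (f y) <= k%:E * d x y + c%:E &
    forall u, E u -> exists2 x, D x & e (f x) u <= c%:E].

Definition quasi_isometric : Prop := exists f : T -> U, quasi_isometry f.

End QuasiIsometry.

(* Main.v *)
(* A string of segments in a piecewise Euclidean complex of bounded dimension is
   shadowed by an edge path whose number of steps is linear in its length, so it
   suffices to compare 1-skeleta. The vertex v_g is sent back to g, and a coset to
   one of its elements. If h = g m, then v_g and v_h are both joined to the coset
   {h}; conversely, the point to prove is that two elements of a coset of a
   spherical A_T are at bounded distance in the monoid Cayley graph, that is, that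
   every element of A_T is a fraction of two positive elements.

   The Garside element that provides such fractions is read off a numbers game
   (Mozes, Eriksson): a position is a real function on the vertices, and a legal
   move reflects at a vertex where the position is positive. The game is locally
   confluent, and the two sides of each confluence diagram are the two sides of an
   Artin relation. When the Coxeter group is finite the game terminates, so all
   maximal plays from the constant position 1 are words for one element d of the
   Artin monoid. Such a play can start with any generator x, and if x u is maximal,
   then u is itself legal from 1 and extends to a maximal play u y by one move.
   Hence d = x u = u y, so that x^-1 = u d^-1 and x d = d y. *)
Require Import Defs.
From mathcomp Require Import all_boot all_order all_algebra.
From mathcomp Require Import boolp classical_sets functions cardinality fsbigop.
From mathcomp Require Import reals constructive_ereal ereal trigo.
From mathcomp Require Import ring lra zify.

Set Implicit Arguments.
Unset Strict Implicit.
Unset Printing Implicit Defensive.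

Import Order.TTheory GRing.Theory Num.Theory.
Local Open Scope ring_scope.

(** * The numbers game *)

Fixpoint alt (X : Type) (n : nat) (x y : X) : seq X :=
  if n is n'.+1 then x :: alt n' y x else [::].

Lemma size_alt (X : Type) n (x y : X) : size (alt n x y) = n.
Proof. by elim: n x y => //= n IHn x y; rewrite IHn. Qed.

Lemma alternatingE (X : Type) n (x y : X) :
  Defs.alternating n x y = [seq (z, false) | z <- alt n x y].
Proof. by elim: n x y => //= n IHn x y; rewrite IHn. Qed.

Section NumbersGame.
Variables (R : realType) (Gamma : labelled_graph).
Local Notation X := (vertex Gamma).
Local Notation position := {ffun X -> R}.
Implicit Types (a b : position) (s t x : X) (u v w : seq X).

(** This is -2 times the canonical bilinear form of the Coxeter group on simple roots, a non-edge
    counting as label infinity. A position is a linear functional given by its values on the simple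
    roots, and [fire] is the contragredient reflection. *)
Definition weight s : position :=
  [ffun t => if s == t then - 2 else
             if edge s t then 2 * cos (pi / (label s t)%:R) else 2].

Definition fire a s : position := [ffun t => a t + a s * weight s t].

Definition play a w : position := foldl fire a w.

Fixpoint legal a w : bool :=
  if w is s :: w' then (0 < a s) && legal (fire a s) w' else true.

Definition terminal a : Prop := forall s, a s <= 0.

Lemma weight_diag s : weight s s = - 2.
Proof. by rewrite ffunE eqxx. Qed.

Lemma weight_sym s t : weight s t = weight t s.
Proof.
rewrite !ffunE eq_sym edge_sym; case: eqP => // _.
by case: ifP => // ets; rewrite (label_sym ets).
Qed.

Lemma fireE a s t : fire a s t = a t + a s * weight s t.
Proof. by rewrite ffunE. Qed.

Lemma fire_diag a s : fire a s s = - a s.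
Proof. by rewrite fireE weight_diag; ring. Qed.

Lemma fireK s : involutive (fire^~ s).
Proof. by move=> a; apply/ffunP=> t; rewrite fireE fire_diag fireE; ring. Qed.

Lemma fireN a s : fire (- a) s = - fire a s.
Proof. by apply/ffunP=> t; rewrite !(fireE, ffunE); ring. Qed.

Lemma fire_weight s : fire (weight s) s = - weight s.
Proof. by apply/ffunP=> t; rewrite fireE weight_diag [RHS]ffunE; ring. Qed.

Lemma play_cat a u v : play a (u ++ v) = play (play a u) v.
Proof. exact: foldl_cat. Qed.

Lemma legal_cat a u v : legal a (u ++ v) = legal a u && legal (play a u) v.
Proof. by elim: u a => //= s u IHu a; rewrite IHu andbA. Qed.

Lemma playN a w : play (- a) w = - play a w.
Proof. by elim: w a => //= s w IHw a; rewrite fireN IHw. Qed.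

Lemma play_revK w a : play (play a w) (rev w) = a.
Proof.
elim: w a => //= s w IHw a.
by rewrite rev_cons -cats1 play_cat IHw /= fireK.
Qed.

Lemma legal_rev a w : legal a w -> legal (- play a w) (rev w).
Proof.
elim: w a => //= s w IHw a /andP[as_gt0 leg_w].
rewrite rev_cons -cats1 legal_cat IHw //= playN play_revK andbT.
by rewrite ffunE fire_diag opprK.
Qed.

(** * Alternating plays at two vertices *)

Section Dihedral.
Variables (s t : X) (c : R) (F : nat -> R).
Hypotheses (wst : weight s t = c) (Frec : forall i, F i.+2 = c * F i.+1 - F i).

(** One firing shifts the index of the recurrence by one and swaps the two vertices. The values
    fired along an alternating play are thus consecutive terms of [F], and legality is their
    positivity. *)
Let fire_step s' t' k a : weight s' t' = c ->
  a s' = F k.+1 -> a t' = - F k ->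
  fire a s' t' = F k.+2 /\ fire a s' s' = - F k.+1.
Proof.
move=> ws' as' at'; rewrite fire_diag fireE ws' as' at' Frec; split=> //.
by rewrite addrC mulrC.
Qed.

Lemma alt_legal n k a : a s = F k.+1 -> a t = - F k ->
  (forall i, (k < i <= k + n)%N -> 0 < F i) -> legal a (alt n s t).
Proof.
have wts : weight t s = c by rewrite weight_sym.
elim: n k s t wst wts a => //= n IHn k s' t' ws wt a as' at' Fpos.
have [e1 e2] := fire_step ws as' at'.
rewrite as' Fpos ?(IHn k.+1) // => [i /andP[ki ik]|].
  by apply: Fpos; rewrite (ltn_trans _ ki) //= -addSnnS.
by rewrite ltnSn /= addnS ltnS leq_addr.
Qed.

Lemma alt_play n k a x : a s = F k.+1 -> a t = - F k ->
  play a (alt n.*2 s t) x = a x + (\sum_(i < n) F (k + i.*2).+1) * weight s x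
                                + (\sum_(i < n) F (k + i.*2).+2) * weight t x.
Proof.
elim: n k a => [|n IHn] k a ask atk.
  by rewrite !big_ord0 !mul0r !addr0.
have wts : weight t s = c by rewrite weight_sym.
have [e1 e2] := fire_step wst ask atk.
have [e3 e4] := fire_step wts e1 e2.
rewrite doubleS /= (IHn k.+2) // !big_ord_recl /= !addn0.
rewrite [fire (fire a s) t x]fireE e1 [fire a s x]fireE ask.
under [X in _ = _ + (_ + X) * _ + _]eq_bigr do rewrite /bump add1n doubleS !addnS.
under [X in _ = _ + (_ + X) * _]eq_bigr do rewrite /bump add1n doubleS !addnS.
under eq_bigr do rewrite !addSn.
under [X in _ + X * _ = _]eq_bigr do rewrite !addSn.
ring.
Qed.

End Dihedral.

Section Edge.
Variables (s t : X).
Hypothesis (est : edge s t).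
Let m := label s t.
Let theta : R := pi / m%:R.
Let m_gt0 : 0 < m%:R :> R.
Proof. by rewrite ltr0n (leq_trans _ (label_ge2 est)). Qed.

Let theta_m : m%:R * theta = pi.
Proof. by rewrite mulrC divfK ?gt_eqF. Qed.

Let theta_gt0 : 0 < theta.
Proof. by rewrite divr_gt0 ?pi_gt0. Qed.

Let theta_le : theta <= pi / 2.
Proof.
have := label_ge2 est; rewrite -/m -(ler_nat R) => m2.
by rewrite ler_pM2l ?pi_gt0 // lef_pV2 ?posrE.
Qed.

Let sin_gt0 : 0 < sin theta.
Proof.
rewrite sin_gt0_pi // theta_gt0 /=.
by have := pi_gt0 R; have := theta_le; lra.
Qed.

Let neq_st : s != t.
Proof. by apply: contraTneq est => ->; rewrite edge_irrefl. Qed.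

Lemma weight_edge : weight s t = 2 * cos theta.
Proof. by rewrite ffunE (negbTE neq_st) est. Qed.

(** The solution of the recurrence for [c = 2 * cos theta] with [F 1 = p] and [- F 0 = q], where p
    and q will be the values of a position at [s] and [t]. *)
Let F (p q : R) (i : nat) : R :=
  (p * sin (i%:R * theta) + q * sin ((i%:R - 1) * theta)) / sin theta.

Let F_rec p q i : F p q i.+2 = 2 * cos theta * F p q i.+1 - F p q i.
Proof.
have sin_rec (x : R) : sin (x + theta) = 2 * cos theta * sin x - sin (x - theta).
  by rewrite sinB sinD; ring.
rewrite /F mulrA -mulrBl; congr (_ / _).
have -> : i.+2%:R * theta = i.+1%:R * theta + theta by rewrite -!natr1; ring.
have -> : (i.+2%:R - 1) * theta = (i.+1%:R - 1) * theta + theta.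
  by rewrite -!natr1; ring.
rewrite !sin_rec.
have -> : i.+1%:R * theta - theta = i%:R * theta by rewrite -!natr1; ring.
have -> : (i.+1%:R - 1) * theta - theta = (i%:R - 1) * theta by rewrite -!natr1; ring.
ring.
Qed.

Let F1 p q : F p q 1 = p.
Proof. by rewrite /F mul1r subrr mul0r sin0 mulr0 addr0 mulfK ?gt_eqF. Qed.

Let F0 p q : - F p q 0 = q.
Proof.
rewrite /F mul0r sin0 mulr0 add0r sub0r mulN1r sinN mulrN mulNr opprK.
by rewrite mulfK ?gt_eqF.
Qed.

Let F_antiperiodic p q i : F p q (i + m) = - F p q i.
Proof.
rewrite /F -mulNr opprD -!mulrN -!sinDpi; congr ((_ * sin _ + _ * sin _) / _);
by rewrite -theta_m natrD; ring.
Qed.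

Let F_gt0 p q i : 0 < p -> 0 < q -> (0 < i <= m)%N -> 0 < F p q i.
Proof.
move=> p0 q0 /andP[i0 im]; rewrite divr_gt0 //.
(* At [i = m] the first sine vanishes and the second equals [sin theta]; below [m] the first is
   positive and the second nonnegative. *)
have [eim|ltim] := eqVneq i m.
  rewrite eim theta_m sinpi mulr0 add0r mulr_gt0 // mulrBl theta_m mul1r.
  by rewrite sinB sinpi cospi mul0r mulN1r sub0r opprK.
have i1 : 1 <= i%:R :> R by rewrite ler1n.
have im1 : (i%:R : R) < m%:R by rewrite ltr_nat ltn_neqAle ltim im.
rewrite ltr_pwDl // ?mulr_gt0 // ?mulr_ge0 ?(ltW q0) //.
  rewrite sin_gt0_pi // mulr_gt0 ?(lt_le_trans _ i1) //=.
  by rewrite -theta_m ltr_pM2r.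
rewrite sin_ge0_pi // mulr_ge0 ?subr_ge0 ?(ltW theta_gt0) //=.
by rewrite -theta_m ler_pM2r //; lra.
Qed.

Lemma alt_edge_legal a : 0 < a s -> 0 < a t -> legal a (alt m s t).
Proof.
move=> as0 at0; apply: (@alt_legal s t _ (F (a s) (a t)) weight_edge _ m 0).
- exact: F_rec.
- by rewrite F1.
- by rewrite F0.
- by move=> i; rewrite add0n; exact: F_gt0.
Qed.

Let sum_shift n (f : nat -> R) : f n = f 0%N -> \sum_(i < n) f i.+1 = \sum_(i < n) f i.
Proof.
move=> fn; have := erefl (\sum_(i < n.+1) f i); rewrite {1}big_ord_recl big_ord_recr /=.
by rewrite fn addrC => /addrI.
Qed.

(** Every other term of [F] forms a sequence of period [m] that satisfies the recurrence for the
    doubled angle. Summed over a period, this recurrence says that the sum is killed by 4 sin^2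
    theta. *)
Let F_sum p q k : \sum_(i < m) F p q (k + i.*2) = 0.
Proof.
set f := fun i => F p q (k + i.*2).
have f_per i : f (i + m)%N = f i.
  by rewrite /f doubleD -(addnn m) !addnA !F_antiperiodic opprK.
have f_rec i : f i.+2 = ((2 * cos theta) ^+ 2 - 2) * f i.+1 - f i.
  rewrite /f !doubleS !addnS; rewrite !F_rec; ring.
have e1 : \sum_(i < m) f i.+1 = \sum_(i < m) f i := sum_shift (f_per 0%N).
have : \sum_(i < m) f i.+2 = \sum_(i < m) f i.+1 :=
  sum_shift (f := fun i => f i.+1) (f_per 1%N).
under eq_bigr do rewrite f_rec.
rewrite sumrB -mulr_sumr e1; move: (\sum_(i < m) f i) => S eS.
have /eqP : (4 * sin theta ^+ 2) * S = 0.
  transitivity (S - (((2 * cos theta) ^+ 2 - 2) * S - S)).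
    by rewrite sin2cos2; ring.
  by rewrite eS subrr.
have sin2_neq0 : 4 * sin theta ^+ 2 != 0 by rewrite gt_eqF // mulr_gt0 ?exprn_gt0.
by rewrite mulf_eq0 (negbTE sin2_neq0) => /eqP.
Qed.

(** The relation (st)^m = 1 of the reflection representation: the total change is a combination of
    two weights whose coefficients are sums of [F] over a period. *)
Lemma alt_play_full a : play a (alt m.*2 s t) = a.
Proof.
apply/ffunP=> x; rewrite (@alt_play s t _ (F (a s) (a t)) weight_edge _ m 0).
- under eq_bigr do rewrite add0n -add1n.
  under [X in _ + X * _]eq_bigr do rewrite add0n -add2n.
  by rewrite !F_sum !mul0r !addr0.
- exact: F_rec.
- by rewrite F1.
- by rewrite F0.
Qed.

End Edge.

(** For weight 2 the recurrence has affine solutions; this one stays positive from index 1 on, so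
    two positive vertices without an edge allow arbitrarily long plays. *)
Lemma alt_nonedge_legal n s t a : s != t -> ~~ edge s t ->
  0 < a s -> 0 < a t -> legal a (alt n s t).
Proof.
move=> st nst as0 at0.
apply: (@alt_legal s t 2 (fun i => i%:R * a s + (i%:R - 1) * a t) _ _ n 0).
- by rewrite ffunE (negbTE st) (negbTE nst).
- by move=> i; rewrite -!natr1; ring.
- by rewrite mul1r subrr mul0r addr0.
- by rewrite mul0r sub0r mulN1r add0r opprK.
- move=> i /andP[i0 _]; rewrite ltr_pwDl ?mulr_gt0 ?ltr0n //.
  by rewrite mulr_ge0 ?(ltW at0) // subr_ge0 ler1n.
Qed.

End NumbersGame.

(** * Confluence of the game and the Garside element *)

Lemma altSr (X : Type) n (x y : X) :
  alt n.+1 x y = rcons (alt n x y) (if odd n then y else x).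
Proof.
elim: n x y => // n IHn x y.
by rewrite -[LHS]/(x :: alt n.+1 y x) IHn /= if_neg.
Qed.

Lemma alt_double (X : Type) n (x y : X) :
  alt n.*2 x y = alt n x y ++ rev (alt n y x).
Proof.
elim: n x y => // n IHn x y.
rewrite doubleS altSr /= odd_double IHn rev_cons.
by rewrite -!cats1 -catA.
Qed.

Lemma presented_eq_mono (X : choiceType) (r r' : word X -> word X -> Prop) u v :
  (forall u v, r u v -> r' u v) -> presented_eq r u v -> presented_eq r' u v.
Proof.
move=> rr'; elim=> {u v} [u|u v _ /presented_sym //|u v w _ + _|a b x e|a b u v ruv].
- exact: presented_refl.
- exact: presented_trans.
- exact: presented_cancel.
- exact/presented_relator/rr'.
Qed.

Definition braid_eq (Gamma : labelled_graph) (u v : seq (vertex Gamma)) : Prop :=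
  presented_eq (@artin_relator Gamma) [seq (x, false) | x <- u]
                                      [seq (x, false) | x <- v].

Section BraidEq.
Variable Gamma : labelled_graph.
Implicit Types u v w : seq (vertex Gamma).

Lemma braid_refl u : braid_eq u u.
Proof. exact: presented_refl. Qed.

Lemma braid_trans u v w : braid_eq u v -> braid_eq v w -> braid_eq u w.
Proof. exact: presented_trans. Qed.

Lemma braid_cat u u' v v' :
  braid_eq u u' -> braid_eq v v' -> braid_eq (u ++ v) (u' ++ v').
Proof. by rewrite /braid_eq !map_cat; exact: presented_eq_cat. Qed.

Lemma braid_alt (s t : vertex Gamma) : edge s t ->
  braid_eq (alt (label s t) s t) (alt (label s t) t s).
Proof.
move=> est; rewrite /braid_eq -!alternatingE.
have := @presented_relator _ (@artin_relator Gamma) [::] [::].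
by move=> /(_ _ _ (ex_intro _ s (ex_intro _ t (And3 est erefl erefl)))); rewrite !cats0.
Qed.

End BraidEq.

Section Confluence.
Variables (R : realType) (Gamma : labelled_graph).
Local Notation X := (vertex Gamma).
Local Notation position := {ffun X -> R}.
Implicit Types (a b : position) (s t x : X) (u v w : seq X).

Lemma play_alt s t a : edge s t ->
  play a (alt (label s t) s t) = play a (alt (label s t) t s).
Proof.
move=> est; have := alt_play_full est a.
rewrite alt_double play_cat => e.
by rewrite -[in RHS]e -[X in _ = play _ X]revK play_revK.
Qed.

(** Inverse letters are played like the letters themselves, [fire] being an involution, so the game
    is an action of the Coxeter group. *)
Lemma coxeter_play (u v : word X) a :
  presented_eq (@coxeter_relator Gamma) u v ->
  play a [seq l.1 | l <- u] = play a [seq l.1 | l <- v].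
Proof.
move=> uv; elim: uv a => {u v} [u|u v _ IH|u v w _ IHu _ IHv|u v x e|u v u' v' r] a //.
- by rewrite IHu.
- by rewrite !map_cat !play_cat /= fireK.
- rewrite !map_cat !play_cat; congr play.
  case: r => [[s [t [est -> ->]]]|[s [-> ->]]]; last by rewrite /= fireK.
  have unl n x y : [seq l.1 | l <- Defs.alternating n x y] = alt n x y :> seq X.
    by rewrite alternatingE -map_comp map_id.
  by rewrite !unl play_alt.
Qed.

Lemma braid_play u v a : braid_eq u v -> play a u = play a v.
Proof.
move=> /(presented_eq_mono (r' := @coxeter_relator Gamma)) uv.
have /uv/(coxeter_play a) : forall u v : word X,
  artin_relator u v -> coxeter_relator u v by left.
by rewrite -!map_comp !map_id.
Qed.

Definition run a w : Prop := legal a w /\ terminal (play a w).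

(* Two legal first moves s and t are completed to the same position by the two
   alternating words of an Artin relation, so the diamond lemma produces exactly
   the relations of the Artin monoid. *)
Lemma confluence n a w v : size w = n -> run a w -> legal a v ->
  exists v', [/\ run a (v ++ v'), size (v ++ v') = n & braid_eq w (v ++ v')].
Proof.
elim: n a w v => [|n IHn] a w v.
  move=> /size0nil -> [_ term_a]; case: v => [|t v /= /andP[at0 _]].
    by exists [::]; split=> //; exact: braid_refl.
  by have := term_a t; rewrite leNgt at0.
case: w => // s w [sz_w] [/= /andP[as0 leg_w] term_w].
case: v => [|t v] /=.
  move=> _; exists (s :: w); split; rewrite /= ?sz_w //; last exact: braid_refl.
  by split=> //=; rewrite as0.
move=> /andP[at0 leg_v].
have braid_cons x u u' : braid_eq u u' -> braid_eq (x :: u) (x :: u').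
  exact: (braid_cat (braid_refl [:: x])).
have [st|st] := eqVneq s t.
  subst t; have [v' [[leg term] sz br]] := IHn _ _ _ sz_w (conj leg_w term_w) leg_v.
  by exists v'; split=> /=; [split=> //=; rewrite as0|rewrite sz|exact: braid_cons].
case est : (edge s t); last first.
  (* Without an edge, a legal play of n + 2 moves would exist, while maximal plays have n + 1. *)
  have /andP[_ leg] : (0 < a s) && legal (fire a s) (alt n.+1 t s).
    exact: (alt_nonedge_legal n.+2 st (negbT est) as0 at0).
  have [v' [_ sz _]] := IHn _ _ _ sz_w (conj leg_w term_w) leg.
  by move: sz; rewrite /= size_cat size_alt; lia.
have := braid_alt est; have := play_alt a est.
have := alt_edge_legal est as0 at0.
have := alt_edge_legal (a := a) (etrans (edge_sym t s) est) at0 as0.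
rewrite -(label_sym est).
case: (label s t) (label_ge2 est) => // m _ /=.
move=> /andP[_ leg_ts] /andP[_ leg_st] eq_play br.
(* [z] completes the side of the diagram that starts with [s]. Both sides reach the same position,
   so [z] completes the other side with the same length, and induction compares the result with
   [v]. *)
have [z [[leg_z term_z] sz_z br_z]] := IHn _ _ _ sz_w (conj leg_w term_w) leg_st.
have run_z : run (fire a t) (alt m s t ++ z).
  move: leg_z term_z; rewrite /run !legal_cat !play_cat eq_play leg_ts.
  by move=> /andP[_ ->].
have sz_z' : size (alt m s t ++ z) = n.
  by move: sz_z; rewrite !size_cat !size_alt.
have [v' [[leg_v' term_v'] sz_v' br_v']] := IHn _ _ _ sz_z' run_z leg_v.
exists v'; split; [by split=> //=; rewrite at0|by rewrite /= sz_v'|].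
apply: braid_trans (braid_cons _ _ _ br_z) _.
apply: braid_trans (braid_cat br (braid_refl z)) _.
exact: (braid_cons t _ _ br_v').
Qed.

Definition ends a n : Prop := exists2 w, run a w & size w = n.

Lemma ends_inj a m n : ends a m -> ends a n -> m = n.
Proof.
have le_ends k l : ends a k -> ends a l -> (l <= k)%N.
  move=> [w run_w sz_w] [v [leg_v _] <-].
  have [v' [_ <- _]] := confluence sz_w run_w leg_v.
  by rewrite size_cat leq_addr.
by move=> em en; apply/eqP; rewrite eqn_leq !le_ends.
Qed.

Lemma ends_legal a v n : legal a v -> ends a n ->
  exists2 k, ends (play a v) k & n = (size v + k)%N.
Proof.
move=> leg_v [w run_w sz_w].
have [v' [[leg term] <- _]] := confluence sz_w run_w leg_v.
exists (size v'); last by rewrite size_cat.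
exists v' => //; move: leg term; rewrite legal_cat play_cat => /andP[_ ?] ?.
by split.
Qed.

Definition perturb (e : R) a b : position := [ffun x => a x + e * b x].

Lemma fire_perturb e a b s :
  fire (perturb e a b) s = perturb e (fire a s) (fire b s).
Proof. by apply/ffunP=> t; rewrite !(fireE, ffunE); ring. Qed.

Lemma perturb_gt0 (c h : R) : 0 < c ->
  exists2 e0, 0 < e0 & forall e, 0 < e < e0 -> 0 < c + e * h.
Proof.
move=> c0; have h1 : 0 < `|h| + 1 by rewrite ltr_wpDl.
exists (c / (`|h| + 1)); first by rewrite divr_gt0.
move=> e /andP[e0]; rewrite ltr_pdivlMr // => ec.
have : - `|h| <= h by rewrite lerNl ler_normr lexx orbT.
move=> /(ler_wpM2l (ltW e0)); lra.
Qed.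

(** Positivity of the finitely many fired values and strict negativity of the end position are open
    conditions. *)
Lemma perturb_run a b w : legal a w -> (forall s, play a w s < 0) ->
  exists2 e0, 0 < e0 & forall e, 0 < e < e0 -> run (perturb e a b) w.
Proof.
elim: w a b => [|s w IHw] a b /=.
  move=> _ a_lt0.
  have /fin_all_exists2 [f f_gt0 fP] : forall s, exists2 e0 : R, 0 < e0 &
      forall e, 0 < e < e0 -> perturb e a b s < 0.
    move=> s; have [|e0 e00 He0] := @perturb_gt0 (- a s) (- b s).
      by rewrite oppr_gt0.
    exists e0 => // e /He0; rewrite ffunE; lra.
  exists (\big[Num.min/1]_s f s).
    by rewrite lt_bigmin // ltr01; apply/allP.
  move=> e /andP[e0 ef]; split=> // s; apply/ltW/fP; rewrite e0 /=.
  by apply: lt_le_trans ef _; exact: bigmin_le_cond.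
move=> /andP[as0 leg_w] end_lt0.
have [e1 e10 He1] := IHw _ (fire b s) leg_w end_lt0.
have [e2 e20 He2] := perturb_gt0 (b s) as0.
exists (Num.min e1 e2); first by rewrite lt_min e10.
move=> e; rewrite lt_min => /and3P[e0 ee1 ee2].
have [|leg term] := He1 e; first by rewrite e0.
by rewrite /run /= fire_perturb leg ffunE He2 ?e0.
Qed.

Section Terminating.
Hypothesis terminating : forall a, exists n, ends a n.

(** If the value at [s] is negative, firing [s] again is legal and leads back to [a], so m = n + 1;
    if it is positive, n = m + 1; if it is zero, the position does not move. *)
Lemma ends_fire a s m n : ends a n -> ends (fire a s) m -> (n <= m.+1)%N.
Proof.
move=> en em; have [as0|as0|as0] := ltrgtP (a s) 0.
- have [|k ek ->] := @ends_legal (fire a s) [:: s] m _ em.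
    by rewrite /= fire_diag oppr_gt0 as0.
  by move: ek; rewrite /= fireK => /(ends_inj en) ->; lia.
- have [|k ek ->] := @ends_legal a [:: s] n _ en; first by rewrite /= as0.
  by rewrite (ends_inj em ek).
- suff fa : fire a s = a by rewrite fa in em; rewrite (ends_inj en em).
  by apply/ffunP=> t; rewrite fireE as0 mul0r addr0.
Qed.

Lemma ends_play a v m n : ends a n -> ends (play a v) m -> (n <= size v + m)%N.
Proof.
elim: v a n => [|s v IHv] a n en; first by move=> /(ends_inj en) ->.
move=> /= em; have [k ek] := terminating (fire a s).
by apply: leq_trans (ends_fire en ek) _; rewrite addSn ltnS; exact: IHv ek em.
Qed.

Let ones : position := [ffun=> 1].

Let legal_rev_ones u : legal ones u ->
  legal (- play ones u) (rev u) /\ forall x, play (- play ones u) (rev u) x < 0.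
Proof.
move=> leg_u; split=> [|x]; first exact: legal_rev.
by rewrite playN play_revK !ffunE ltrN10.
Qed.

(* If u is legal but u s is not, play backwards from the negated position: s may
   be moved first there, so u s acts as a word shorter than u, whereas a legal
   play of length n shortens every maximal play by n. *)
Lemma legal_ones a u : legal a u -> legal ones u.
Proof.
elim/last_ind: u => // u s IHu; rewrite -cats1 legal_cat /= andbT.
move=> /andP[leg_au aus0]; have leg_u := IHu leg_au.
rewrite legal_cat leg_u /= andbT.
have [leg_rev end_lt0] := legal_rev_ones leg_u.
have [//|ds|ds] := ltrgtP 0 (play ones u s).
- have run_rev : run (- play ones u) (rev u) by split=> // x; exact/ltW/end_lt0.
  have [|w [_ sz_w br_w]] := @confluence _ _ _ [:: s] (erefl _) run_rev.
    by rewrite /= ffunE oppr_gt0 ds.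
  have [n en] := terminating a; have [|k ek nE] := @ends_legal a (rcons u s) n _ en.
    by rewrite -cats1 legal_cat leg_au /= aus0.
  have := braid_play (play a u) br_w; rewrite play_revK /= => aE.
  rewrite -cats1 play_cat /= in ek.
  have {}aE : play a (rev w) = fire (play a u) s by rewrite [in LHS]aE play_revK.
  have := @ends_play a (rev w) k n en; rewrite aE => /(_ ek).
  by move: sz_w; rewrite nE size_rev size_rcons /= size_rev; lia.
(* Here [s] fixes the negated position. Perturb that position to make its value at [s] positive: the
   perturbed position and its image under [s] both stay close to it, so [rev u] is a maximal play
   from each, although the legal move [s] shortens maximal plays by one. *)
- have ds0 : (- play ones u) s = 0 by rewrite ffunE -ds oppr0.
  pose h : position := [ffun x => (x == s)%:R].
  have run_near b := perturb_run b leg_rev end_lt0.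
  have [e1 e10 He1] := run_near h; have [e2 e20 He2] := run_near (fire h s).
  pose e := Num.min e1 e2 / 2.
  have min_gt0 : 0 < Num.min e1 e2 by rewrite lt_min e10.
  have e0 : 0 < e by rewrite divr_gt0.
  have : e < Num.min e1 e2 by rewrite /e; lra.
  rewrite lt_min => /andP[ee1 ee2].
  have end1 : ends (perturb e (- play ones u) h) (size u).
    by exists (rev u); rewrite ?size_rev //; apply: He1; rewrite e0.
  have end2 : ends (fire (perturb e (- play ones u) h) s) (size u).
    exists (rev u); rewrite ?size_rev // fire_perturb.
    have -> : fire (- play ones u) s = - play ones u.
      by apply/ffunP=> t; rewrite fireE ds0 mul0r addr0.
    by apply: He2; rewrite e0.
  have [|k ek] := @ends_legal _ [:: s] _ _ end1.
    by rewrite /= ffunE ds0 ffunE eqxx add0r mulr1 e0.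
  by rewrite /= (ends_inj ek end2); lia.
Qed.

Lemma garside_word : exists d, forall x, exists u y,
  braid_eq d (x :: u) /\ braid_eq d (rcons u y).
Proof.
have [n [d run_d sz_d]] := terminating ones; exists d => x.
have [|u [[leg_xu _] sz_xu br_xu]] := @confluence _ _ _ [:: x] sz_d run_d.
  by rewrite /= ffunE ltr01.
have leg_u : legal ones u by move: leg_xu => /= /andP[_]; exact: legal_ones.
have [u' [_]] := confluence sz_d run_d leg_u.
(* The plays [x :: u] and [u ++ u'] have the same length, so [u'] is a single letter. *)
rewrite -sz_xu size_cat /= -addn1 => /addnI; case: u' => [//|y [|//]] _ br_uy.
by exists u, y; rewrite -cats1.
Qed.

End Terminating.
End Confluence.

(** * Finite Coxeter groups *)

Lemma sub_count_lt (T : eqType) (p q : pred T) (l : seq T) x :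
  {subset p <= q} -> x \in l -> q x -> ~~ p x -> (count p l < count q l)%N.
Proof.
move=> pq xl qx npx; rewrite !(permP (perm_to_rem xl)) /= qx (negbTE npx).
by rewrite add0n add1n ltnS sub_count.
Qed.

Section Termination.
Variables (R : realType) (Gamma : labelled_graph).
Local Notation X := (vertex Gamma).
Local Notation position := {ffun X -> R}.
Local Notation W := (coxeter_group Gamma).
Implicit Types (a b c : position) (s t x : X) (g h : W) (w : seq X).

Lemma play_perturb (e : R) a b w :
  play (perturb e a b) w = perturb e (play a w) (play b w).
Proof. by elim: w a b => //= s w IHw a b; rewrite fire_perturb IHw. Qed.

Definition coxeter_act g a : position := play a [seq l.1 | l <- presented_repr g].

Let cgen s : W := presented_gen (@coxeter_relator Gamma) s.

Lemma coxeter_actM g h a : coxeter_act (g * h)%g a = coxeter_act h (coxeter_act g a).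
Proof.
rewrite /coxeter_act (coxeter_play _ (presented_repr_pi _ _)).
by rewrite map_cat play_cat.
Qed.

Lemma coxeter_act_gen s a : coxeter_act (cgen s) a = fire a s.
Proof. by rewrite /coxeter_act (coxeter_play _ (presented_repr_pi _ _)). Qed.

Lemma coxeter_act1 a : coxeter_act 1%g a = a.
Proof. by rewrite /coxeter_act (coxeter_play _ (presented_repr_pi _ _)). Qed.

Variable L : seq W.
Hypotheses (uniqL : uniq L) (memL : forall g, g \in L).

(* The average over the Coxeter group of the standard inner product; every move
   decreases the product with a strictly positive position. *)
Let form a b : R := \sum_(g <- L) \sum_x coxeter_act g a x * coxeter_act g b x.

Let formC a b : form a b = form b a.
Proof. by apply: eq_bigr => g _; apply: eq_bigr => x _; rewrite mulrC. Qed.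

Let form_perturb e a b c : form (perturb e a b) c = form a c + e * form b c.
Proof.
rewrite /form mulr_sumr -big_split; apply: eq_bigr => g _ /=.
rewrite mulr_sumr -big_split; apply: eq_bigr => x _ /=.
by rewrite /coxeter_act play_perturb ffunE; ring.
Qed.

Let form_fire a b s : form (fire a s) (fire b s) = form a b.
Proof.
have permL : perm_eq [seq (cgen s * g)%g | g <- L] L.
  apply: uniq_perm => //; first by rewrite map_inj_uniq //; exact: mulgI.
  by move=> g; rewrite memL -(mulVKg (cgen s) g) map_f.
rewrite /form -[RHS](perm_big _ permL) big_map /=; apply: eq_bigr => g _.
by apply: eq_bigr => x _; rewrite !coxeter_actM !coxeter_act_gen.
Qed.

Let form_weight_gt0 s : 0 < form (weight R s) (weight R s).
Proof.
rewrite /form (bigD1_seq 1%g) //= ltr_pwDl //.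
  rewrite coxeter_act1 (bigD1 s) //= ltr_pwDl //.
    by rewrite weight_diag mulrNN mulr_gt0.
  by apply: sumr_ge0 => x _; rewrite -expr2 sqr_ge0.
by apply: sumr_ge0 => g _; apply: sumr_ge0 => x _; rewrite -expr2 sqr_ge0.
Qed.

Let fire_perturbE a s : fire a s = perturb (a s) a (weight R s).
Proof. by apply/ffunP=> x; rewrite !ffunE. Qed.

Let ones : position := [ffun=> 1].

(** Firing [s] negates the weight w of [s] and sends [ones] to [ones] + w. Invariance of the form
    then gives 2 <w, ones> = - <w, w>. *)
Let form_weight_lt0 s : form (weight R s) ones < 0.
Proof.
have wN : - weight R s = perturb (- 2) (weight R s) (weight R s).
  by apply/ffunP=> x; rewrite !ffunE; ring.
have := form_fire (weight R s) ones s.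
rewrite fire_weight wN form_perturb fire_perturbE formC form_perturb.
rewrite (formC ones) ffunE mul1r; have := form_weight_gt0 s; lra.
Qed.

Let form_decr a s : 0 < a s -> form (fire a s) ones < form a ones.
Proof.
move=> as0; rewrite fire_perturbE form_perturb.
by rewrite gtrDl pmulr_rlt0 // form_weight_lt0.
Qed.

(** Legal moves strictly lower the product with [ones], which takes finitely many values on the
    orbit of [a]. The induction is on the number of group elements that reach a lower value. *)
Lemma finite_terminating a : exists n, ends a n.
Proof.
pose below g := [pred h | form (coxeter_act h a) ones < form (coxeter_act g a) ones].
rewrite -[a]coxeter_act1; move: (1 : W)%g => g.
move: {2}(count (below g) L) (leqnn (count (below g) L)) => k.
elim: k g => [|k IHk] g le_k.
  exists 0%N, [::] => //; split=> // s; rewrite leNgt; apply/negP => gs0.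
  move: le_k; rewrite leqNgt -has_count => /negP; apply.
  apply/hasP; exists (g * cgen s)%g => //=.
  by rewrite coxeter_actM coxeter_act_gen form_decr.
have [/existsP[s gs0]|] := boolP [exists s, 0 < coxeter_act g a s]; last first.
  rewrite negb_exists => /forallP g0; exists 0%N, [::] => //; split=> // s.
  by rewrite leNgt.
have [|n [w [leg_w term_w] sz_w]] := IHk (g * cgen s)%g.
  rewrite -ltnS (leq_trans _ le_k) //.
  apply: (sub_count_lt _ (memL (g * cgen s)%g)).
  - move=> h; rewrite !inE /= => /lt_trans; apply.
    by rewrite coxeter_actM coxeter_act_gen form_decr.
  - by rewrite /= coxeter_actM coxeter_act_gen form_decr.
  - by rewrite /= ltxx.
exists n.+1, (s :: w); rewrite /= ?sz_w //.
by rewrite /run /= gs0 -coxeter_act_gen -coxeter_actM.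
Qed.

End Termination.

Lemma spherical_garside_word (R : realType) (Gamma : labelled_graph) :
  spherical_type Gamma -> exists d : seq (vertex Gamma), forall x, exists u y,
    braid_eq d (x :: u) /\ braid_eq d (rcons u y).
Proof.
move=> /finite_seqP[l lE].
have memL (g : coxeter_group Gamma) : g \in undup l.
  by rewrite mem_undup; have : [set` l]%classic g by rewrite -lE.
exact: (garside_word (finite_terminating (R := R) (undup_uniq l) memL)).
Qed.

(** * Fractions in special subgroups *)

Section SpecialSubgroups.
Local Open Scope group_scope.
Local Open Scope classical_set_scope.
Variable Gamma : labelled_graph.
Local Notation X := (vertex Gamma).
Local Notation A := (artin_group Gamma).
Local Notation M := (@artin_monoid Gamma).
Implicit Types (g h m n : A) (T : {set X}).

Lemma prod_artin_gen (w : seq X) :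
  \prod_(x <- w) artin_gen x =
  presented_pi (@artin_relator Gamma) [seq (x, false) | x <- w].
Proof.
elim: w => [|x w IHw]; first by rewrite big_nil.
rewrite big_cons IHw; apply/presented_piP.
exact: presented_eq_cat (presented_repr_pi _ _) (presented_repr_pi _ _).
Qed.

Lemma braid_prod (u v : seq X) :
  braid_eq u v -> \prod_(x <- u) artin_gen x = \prod_(x <- v) artin_gen x.
Proof. by move=> uv; rewrite !prod_artin_gen; exact/presented_piP. Qed.

(** A full subgraph inherits edges and labels, so its relators map to relators of the whole
    graph. *)
Lemma braid_full_subgraph T (u v : seq (vertex (full_subgraph T))) :
  braid_eq u v -> braid_eq [seq val x | x <- u] [seq val x | x <- v].
Proof.
pose f (l : vertex (full_subgraph T) * bool) := (val l.1, l.2).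
suff f_eq u' v' : presented_eq (@artin_relator (full_subgraph T)) u' v' ->
    presented_eq (@artin_relator Gamma) [seq f l | l <- u'] [seq f l | l <- v'].
  by move=> /f_eq; rewrite /braid_eq -!map_comp.
elim=> {u v u' v'} [u|u v _ /presented_sym //|u v w _ + _|a b x e|a b u v uv].
- exact: presented_refl.
- exact: presented_trans.
- by rewrite !map_cat; exact: presented_cancel.
- rewrite !map_cat; apply: presented_relator.
  have f_alt k x y : [seq f l | l <- Defs.alternating k x y] =
      Defs.alternating k (val x) (val y) by elim: k x y => //= k IHk x y; rewrite IHk.
  by case: uv => x [y [exy -> ->]]; exists (val x), (val y); rewrite !f_alt.
Qed.

Lemma special_is_subgroup T : is_subgroup (special_subgroup T).
Proof.
split=> [H [[]]//|g h Hg Hh H sH|g Hg H sH].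
  by case: (sH) => -[_ HM _] _; apply: HM; [exact: Hg|exact: Hh].
by case: (sH) => -[_ _ HV] _; apply: HV; exact: Hg.
Qed.

Lemma artin_monoid1 : M 1.
Proof. by exists [::]; rewrite big_nil. Qed.

Lemma artin_monoidM m n : M m -> M n -> M (m * n).
Proof. by move=> [u ->] [v ->]; exists (u ++ v); rewrite big_cat. Qed.

Section Fractions.
Variables (T : {set X}) (d : seq (vertex (full_subgraph T))).
Let pw (w : seq (vertex (full_subgraph T))) : A := \prod_(x <- w) artin_gen (val x).
Hypothesis garside : forall x, exists u y,
  braid_eq d (x :: u) /\ braid_eq d (rcons u y).

Let pw_cat u v : pw (u ++ v) = pw u * pw v. Proof. exact: big_cat. Qed.

Let pw_braid u v : braid_eq u v -> pw u = pw v.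
Proof. by move=> /braid_full_subgraph/braid_prod; rewrite !big_map. Qed.

Let M_pw w : M (pw w).
Proof. by exists [seq val x | x <- w]; rewrite big_map. Qed.

Let D : A := pw d.

Let garside_gen x : exists u y, pw [:: x] * pw u = D /\ pw u * pw [:: y] = D.
Proof.
have [u [y [/pw_braid e1 /pw_braid e2]]] := garside x.
by exists u, y; rewrite -!pw_cat cats1.
Qed.

(** From x u = D = u y follows x D = D y, so D^-1 passes each letter x, turning it into y. Hence
    denominators can be collected on the right. *)
Let conj_D w : exists w', D^-1 * pw w = pw w' * D^-1.
Proof.
elim: w => [|x w [w' IHw]].
  by exists [::]; rewrite /pw big_nil mulg1 mul1g.
have [u [y [e1 e2]]] := garside_gen x; exists (y :: w').
have e3 : pw [:: x] * D = D * pw [:: y] by rewrite -{1}e2 mulgA e1.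
rewrite -[x :: w]cat1s -[y :: w']cat1s !pw_cat -mulgA -IHw !mulgA.
by congr (_ * _); apply: (mulgI D); rewrite !mulgA mulgV mul1g -e3 mulgK.
Qed.

Let conj_DX k w : exists w', D^-1 ^+ k * pw w = pw w' * D^-1 ^+ k.
Proof.
elim: k w => [|k IHk] w; first by exists w; rewrite mulg1 mul1g.
have [w' e] := conj_D w; have [w'' e'] := IHk w'; exists w''.
by rewrite expgSr -mulgA e mulgA e' mulgA.
Qed.

Let frac g : Prop := exists w k, g = pw w * D^-1 ^+ k.

Let frac_pw w : frac (pw w).
Proof. by exists w, 0; rewrite mulg1. Qed.

Let frac_mul g h : frac g -> frac h -> frac (g * h).
Proof.
move=> [w [k ->]] [v [l ->]]; have [v' e] := conj_DX k v.
exists (w ++ v'), (k + l); rewrite pw_cat expgnDr.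
by rewrite -!mulgA (mulgA _ (pw v)) e !mulgA.
Qed.

Let frac_inv g : frac g -> frac g^-1.
Proof.
have frac_gen x : frac (pw [:: x])^-1.
  have [u [_ [e _]]] := garside_gen x; exists u, 1%N.
  by rewrite expg1 -e invgM mulgA mulgV mul1g.
have frac_word w : frac (pw w)^-1.
  elim: w => [|x w IHw]; first by exists [::], 0; rewrite mulg1 /pw big_nil invg1.
  by rewrite -cat1s pw_cat invgM; exact: frac_mul.
move=> [w [k ->]]; elim: k => [|k IHk]; first by rewrite mulg1.
by rewrite expgSr mulgA invgM invgK; apply: frac_mul => //; exact: frac_pw.
Qed.

(** The fractions form a subgroup containing the generators in [T], and the special subgroup is the
    smallest such subgroup. *)
Let frac_special g : special_subgroup T g -> frac g.
Proof.
apply; split; first split.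
- by have := frac_pw [::]; rewrite /pw big_nil.
- exact: frac_mul.
- exact: frac_inv.
- move=> _ [x xT <-]; have := frac_pw [:: exist _ x xT].
  by rewrite /pw big_seq1.
Qed.

Lemma special_fraction g : special_subgroup T g ->
  exists m n, [/\ M m, M n & g = m * n^-1].
Proof.
move=> /frac_special[w [k ->]]; exists (pw w), (D ^+ k); split=> //; last first.
  by rewrite expVgn.
elim: k => [|k IHk]; first exact: artin_monoid1.
by rewrite expgS; exact: (artin_monoidM (M_pw d)).
Qed.

End Fractions.
Lemma spherical_fraction (R : realType) T g :
  spherical_type (full_subgraph T) -> special_subgroup T g ->
  exists m n, [/\ M m, M n & g = m * n^-1].
Proof.
by move=> /(spherical_garside_word R)[d garside]; exact: special_fraction garside _.
Qed.

Lemma spherical_empty : spherical_type (full_subgraph (finset.set0 : {set X})).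
Proof.
apply: (sub_finite_set _ (finite_set1 1)) => g _.
rewrite -[g]presented_reprK; case: (presented_repr g) => [//|[[x x0] e] w].
by have := x0; rewrite inE.
Qed.

End SpecialSubgroups.

(** * Edge paths in piecewise Euclidean complexes *)

Section OneSkeleton.
Local Open Scope classical_set_scope.
Variables (V : Type) (K : simplicial_complex V).
Implicit Types (v w : V).

(** A vertex is adjacent to itself, so an edge path may pause. *)
Definition adjacent v w : Prop := exists s, [/\ simplices K s, s v & s w].

Fixpoint reach n v w : Prop :=
  if n is n'.+1 then exists2 u, adjacent v u & reach n' u w else v = w.

Definition joined N v w : Prop := exists2 n, (n <= N)%N & reach n v w.

Lemma adjacent_sym v w : adjacent v w -> adjacent w v.
Proof. by move=> [s [Ks sv sw]]; exists s. Qed.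

Lemma simplex_vertex s v : simplices K s -> s v -> vertices K v.
Proof. by move=> Ks sv; apply: (simplex_face Ks) => [_ -> //|]; exists v. Qed.

Lemma reach_cat m n u v w : reach m u v -> reach n v w -> reach (m + n) u w.
Proof.
by elim: m u => /= [u -> //|m IHm u [u' ? ?] ?]; exists u' => //; exact: IHm.
Qed.

Lemma joined_refl N v : joined N v v.
Proof. by exists 0%N. Qed.

Lemma joined_cat m n u v w : joined m u v -> joined n v w -> joined (m + n) u w.
Proof.
move=> [k km ruv] [l ln rvw]; exists (k + l)%N; first exact: leq_add.
exact: reach_cat ruv rvw.
Qed.

Lemma joined_adjacent v w : adjacent v w -> joined 1 v w.
Proof. by exists 1%N => //; exists w. Qed.

Lemma joined_sym N v w : joined N v w -> joined N w v.
Proof.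
move=> [n nN vw]; exists n => //; elim: n v vw {nN} => [|n IHn] v //=.
move=> [u vu /IHn wu]; suff : reach (n + 1) w v by rewrite addn1.
apply: (reach_cat wu).
by exists v => //; exact: adjacent_sym.
Qed.

End OneSkeleton.

Section Polygons.
Local Open Scope classical_set_scope.
Variables (R : realType) (V : choiceType) (K : simplicial_complex V).
Implicit Types (x y z : V -> R) (u v w : V) (l : R).

(** Strings with their lengths, in a form that permits induction along the path. *)
Inductive polygon : (V -> R) -> (V -> R) -> R -> Prop :=
| polygon_nil x : realization R K x -> polygon x x 0
| polygon_cons x y z l : realization R K x -> in_common_simplex K x y ->
    polygon y z l -> polygon x z (simplex_dist x y + l).

Lemma polygon_start x y l : polygon x y l -> realization R K x.
Proof. by case. Qed.

Lemma polygonP x y l : polygon x y l <->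
  exists n c, [/\ is_string K n c, c 0%N = x, c n = y & l = string_length n c].
Proof.
split=> [|[n [c]]].
  elim=> {x y l} [x Kx|x y z l Kx xy _ [n [c [[Kc cc] c0 cn ->]]]].
    exists 0%N, (fun=> x); split=> //; last by rewrite /string_length big_geq.
  exists n.+1, (fun i => if i is j.+1 then c j else x); split=> //.
    by split=> -[|i] //=; rewrite ?c0 //; [exact: Kc|exact: cc].
  by rewrite /string_length big_nat_recl // c0.
elim: n c x y l => [|n IHn] c x y l [[Kc cc] <- <- ->].
  by rewrite /string_length big_geq //; apply: polygon_nil; exact: Kc.
rewrite /string_length big_nat_recl //; apply: polygon_cons.
- exact: Kc.
- exact: cc.
- apply: (IHn (fun i => c i.+1)); split=> //.
  by split=> i ile; [exact: Kc|exact: cc].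
Qed.

Lemma length_distE x y :
  length_dist R K x y = ereal_inf [set l%:E | l in polygon x y].
Proof.
congr ereal_inf; apply/seteqP; split=> l.
  move=> [n [c [? ? ? ->]]]; exists (string_length n c) => //.
  by apply/polygonP; exists n, c.
by move=> [_ /polygonP[n [c [? ? ? ->]]] <-]; exists n, c.
Qed.

Lemma polygon_ge0 x y l : polygon x y l -> 0 <= l.
Proof. by elim=> // {x y l} x y z l _ _ _ l0; rewrite addr_ge0 ?sqrtr_ge0. Qed.

Lemma fsum_supp (f : V -> R) (r : seq V) : uniq r ->
  (forall v, v \notin r -> f v = 0) -> \sum_(v \in [set: V]) f v = \sum_(v <- r) f v.
Proof.
move=> ur fr; rewrite (fsbigE r) // => [|v _]; last exact: fr.
by apply: eq_bigl => v; rewrite in_setT.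
Qed.

Lemma realization_seq x : realization R K x ->
  exists2 r : seq V, uniq r & forall v, v \notin r -> x v = 0.
Proof.
move=> [_ /simplex_finite/finite_seqP[r rE] _]; exists (undup r).
  exact: undup_uniq.
move=> v; rewrite mem_undup => vr; apply/eqP; apply: contraNT vr => xv.
by have : vertex_support x v := xv; rewrite rE.
Qed.

Lemma realization_seq2 x y : realization R K x -> realization R K y ->
  exists2 r : seq V, uniq r & forall v, v \notin r -> x v = 0 /\ y v = 0.
Proof.
move=> /realization_seq[r1 _ x0] /realization_seq[r2 _ y0].
exists (undup (r1 ++ r2)); first exact: undup_uniq.
by move=> v; rewrite mem_undup mem_cat negb_or => /andP[/x0 ? /y0].
Qed.

Lemma realization_le1 x v : realization R K x -> x v <= 1.
Proof.
move=> Kx; have [r ur xr] := realization_seq Kx; have [x0 _ x1] := Kx.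
have [vr|/xr ->] := boolP (v \in r); last exact: ler01.
rewrite -x1 (fsum_supp ur xr) (bigD1_seq v) //= lerDl.
by apply: sumr_ge0 => w _; exact: x0.
Qed.

(** Coordinates lie in [0, 1], so each (x v - y v)^2 is at most x v + y v, and these bounds sum to
    2. *)
Lemma simplex_dist_le1 x y : realization R K x -> realization R K y ->
  simplex_dist x y <= 1.
Proof.
move=> Kx Ky; have [r ur xyr] := realization_seq2 Kx Ky.
have [x0 _ x1] := Kx; have [y0 _ y1] := Ky.
rewrite /simplex_dist (fsum_supp ur); last first.
  by move=> v /xyr[-> ->]; rewrite subrr expr0n.
rewrite -[leRHS]sqrtr1 ler_wsqrtr // ler_pdivrMl // mulr1.
have -> : 2 = \sum_(v <- r) (x v + y v).
  rewrite big_split /= -!fsum_supp ?x1 ?y1 //; by move=> v /xyr[].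
apply: ler_sum => v _; have := x0 v; have := y0 v.
have := realization_le1 v Kx; have := realization_le1 v Ky; nra.
Qed.

(** Keeping only the term of [v] in the sum gives the factor sqrt 2, which is rounded up to 2. *)
Lemma coord_le_simplex_dist x y v : realization R K x -> realization R K y ->
  x v - y v <= 2 * simplex_dist x y.
Proof.
move=> Kx Ky; have [r ur xyr] := realization_seq2 Kx Ky.
have f0 w : w \notin r -> (x w - y w) ^+ 2 = 0.
  by move=> /xyr[-> ->]; rewrite subrr expr0n.
rewrite (le_trans (ler_norm _)) // -sqrtr_sqr -[X in X * _]ger0_norm // -sqrtr_sqr.
rewrite -sqrtrM ?sqr_ge0 // ler_wsqrtr // (fsum_supp ur f0).
have sum_ge0 P : 0 <= \sum_(w <- r | P w) (x w - y w) ^+ 2.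
  by apply: sumr_ge0 => w _; exact: sqr_ge0.
have [vr|/f0 ->] := boolP (v \in r); last first.
  by rewrite !mulr_ge0 ?invr_ge0 // sumr_ge0.
rewrite (bigD1_seq v) //=; set S := \sum_(_ <- _ | _) _.
have : 0 <= S := sum_ge0 _; have := sqr_ge0 (x v - y v).
by move: (_ ^+ 2) S => q S q0 S0; rewrite mulrA expr2 mulfK ?pnatr_eq0 //; lra.
Qed.

Lemma vertex_pointE v w : (vertex_point R v w != 0) = (w == v).
Proof. by rewrite /vertex_point; case: (w == v); rewrite ?oner_eq0 ?eqxx. Qed.

Lemma realization_vertex v : vertices K v -> realization R K (vertex_point R v).
Proof.
move=> Kv; split=> [w||].
- exact: ler0n.
- have -> // : vertex_support (vertex_point R v) = [set v].
  by apply/seteqP; split=> w /=; rewrite /vertex_support /= vertex_pointE => /eqP.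
- rewrite (fsum_supp (r := [:: v])) // ?big_seq1 /vertex_point ?eqxx // => w.
  by rewrite inE => /negbTE ->.
Qed.

Lemma realization_support x : realization R K x -> exists v, x v != 0.
Proof. by move=> [_ /simplex_nonempty]. Qed.

Lemma vertices_support x v : realization R K x -> x v != 0 -> vertices K v.
Proof. by move=> [_ Kx _] xv; exact: simplex_vertex Kx _. Qed.

Lemma polygon_vertices m n v w y l : (n <= m)%N -> reach K n v w -> vertices K v ->
  polygon (vertex_point R w) y l ->
  exists2 l', l' <= m%:R + l & polygon (vertex_point R v) y l'.
Proof.
elim: n m v => /= [|n IHn] m v nm.
  by move=> -> _ pwy; exists l => //; rewrite lerDr.
case: m nm => // m nm [u vu ruw] Kv pwy.
have Ku : vertices K u by have [s [Ks _ su]] := vu; exact: simplex_vertex Ks su.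
have [l' ll' puy] := IHn m u nm ruw Ku pwy.
exists (simplex_dist (vertex_point R v) (vertex_point R u) + l').
  have := simplex_dist_le1 (realization_vertex Kv) (realization_vertex Ku).
  by rewrite -natr1; lra.
apply: polygon_cons puy; first exact: realization_vertex.
have [s [Ks sv su]] := vu; exists s; split=> //.
  by move=> z; rewrite /vertex_support /= vertex_pointE => /eqP ->.
by move=> z; rewrite /vertex_support /= vertex_pointE => /eqP ->.
Qed.

(** The extra 2 pays for the segments from [x] to [v] and from [w] to [y]. *)
Lemma polygon_joined N v w x y : joined K N v w ->
  realization R K x -> realization R K y -> x v != 0 -> y w != 0 ->
  exists2 l, l <= N%:R + 2 & polygon x y l.
Proof.
move=> [n nN vw] Kx Ky xv yw.
have Kv := vertices_support Kx xv; have Kw := vertices_support Ky yw.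
have to_vertex u z : realization R K z -> z u != 0 ->
    in_common_simplex K z (vertex_point R u).
  move=> [_ Kz _] zu; exists (vertex_support z); split=> // t.
  by rewrite /vertex_support /= vertex_pointE => /eqP ->.
have pwy : polygon (vertex_point R w) y (simplex_dist (vertex_point R w) y + 0).
  apply: polygon_cons (polygon_nil Ky); first exact: realization_vertex.
  by have [s [? ? ?]] := to_vertex _ _ Ky yw; exists s.
have [l lN pvy] := polygon_vertices nN vw Kv pwy.
exists (simplex_dist x (vertex_point R v) + l).
  have := simplex_dist_le1 Kx (realization_vertex Kv).
  by have := simplex_dist_le1 (realization_vertex Kw) Ky; lra.
by apply: polygon_cons pvy => //; exact: to_vertex.
Qed.

(* In a complex of bounded dimension every point is in the open star of a vertex
   with barycentric coordinate at least alpha. *)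
Definition fat (alpha : R) : Prop :=
  0 < alpha /\ forall x, realization R K x -> exists v, alpha <= x v.

(** If all coordinates were below 1/(N + 1), their sum over at most N vertices would be at most N/(N
    + 1), hence less than 1. *)
Lemma bounded_fat (N : nat) :
  (forall s, simplices K s -> exists2 r : seq V, (size r <= N)%N & s `<=` [set` r]) ->
  fat N.+1%:R^-1.
Proof.
move=> bnd; split=> [|x [x0 Kx x1]]; first by rewrite invr_gt0 ltr0n.
have [r szr sr] := bnd _ Kx.
apply: contrapT => /forallNP small.
have small' v : x v < N.+1%:R^-1 by rewrite ltNge; exact/negP/small.
suff : \sum_(v <- undup r) x v < 1.
  rewrite -fsum_supp ?x1 ?ltxx ?undup_uniq // => v.
  by rewrite mem_undup; apply: contraNeq => xv; exact: sr.
apply: (@le_lt_trans _ _ (\sum_(v <- undup r) N.+1%:R^-1)).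
  by apply: ler_sum => v _; exact/ltW/small'.
rewrite big_const_seq count_predT iter_addr_0 -[X in X < _]mulr_natl.
rewrite ltr_pdivrMr ?ltr0n //.
by rewrite mul1r ltr_nat ltnS (leq_trans (size_undup r)).
Qed.

(* Follow the polygon, staying with a vertex v as long as its barycentric
   coordinate is nonzero; when it vanishes, jump to a vertex of coordinate at
   least alpha, which has cost at least alpha / 2 in length. *)
Lemma polygon_reach alpha x y l : fat alpha -> polygon x y l ->
  forall v w, x v != 0 -> y w != 0 ->
  exists2 k, reach K k v w & k%:R * alpha <= 2 * l + 2 * alpha - Num.min (x v) alpha.
Proof.
move=> [a0 fatK]; elim=> {x y l} [x Kx|x y z l Kx xy pyz IH] v w xv zw.
  have min_le : Num.min (x v) alpha <= alpha by rewrite ge_min lexx orbT.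
  exists 1%N; last by lra.
  by exists w => //; have [_ Kx' _] := Kx; exists (vertex_support x).
have Ky := polygon_start pyz.
have := coord_le_simplex_dist v Kx Ky; set d := simplex_dist x y => dxy.
have d0 : 0 <= d by exact: sqrtr_ge0.
have [yv|yv] := eqVneq (y v) 0.
  have [v' av'] := fatK _ Ky.
  have yv' : y v' != 0 by rewrite gt_eqF // (lt_le_trans a0).
  have [k rk] := IH v' w yv' zw; rewrite (min_idPr av') => ka.
  exists k.+1.
    exists v' => //; have [s [Ks xs ys]] := xy.
    by exists s; split=> //; [exact: xs|exact: ys].
  have : Num.min (x v) alpha <= x v by rewrite ge_min lexx.
  by rewrite -natr1; move: dxy; rewrite yv; lra.
have [k rk ka] := IH v w yv zw; exists k => //.
(* The truncated coordinate acts as a credit: a segment lowers it by at most twice its length, and a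
   jump restores it to [alpha]. *)
suff : Num.min (x v) alpha <= Num.min (y v) alpha + 2 * d by lra.
by case: (lerP (x v) alpha) => ?; case: (lerP (y v) alpha) => ?; lra.
Qed.

End Polygons.

(** * From maps of 1-skeleta to quasi-isometries *)

Section SkeletonQuasiIsometry.
Local Open Scope classical_set_scope.
Variables (R : realType) (V V' : choiceType).
Variables (K : simplicial_complex V) (K' : simplicial_complex V').
Variables (alpha alpha' : R) (B : nat) (f : V -> V') (g : V' -> V).
Hypotheses (fatK : fat K alpha) (fatK' : fat K' alpha').
Hypotheses (f_vertex : forall v, vertices K v -> vertices K' (f v)).
Hypotheses (g_vertex : forall v, vertices K' v -> vertices K (g v)).
Hypotheses (f_adj : forall v w, adjacent K v w -> joined K' B (f v) (f w)).
Hypotheses (g_adj : forall v w, adjacent K' v w -> joined K B (g v) (g w)).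
Hypotheses (gfK : forall v, g (f v) = v).
Hypotheses (fgK : forall v, vertices K' v -> joined K' B (f (g v)) v).

Let map_reach (U U' : choiceType) (L : simplicial_complex U)
    (L' : simplicial_complex U') (h : U -> U') n v w :
  (forall v w, adjacent L v w -> joined L' B (h v) (h w)) ->
  reach L n v w -> joined L' (n * B) (h v) (h w).
Proof.
move=> h_adj; elim: n v => /= [v ->|n IHn v [u vu uw]]; first exact: joined_refl.
exact: joined_cat (h_adj _ _ vu) (IHn _ uw).
Qed.

(** A polygon of length l is shadowed by at most 2 l / alpha + 2 edges, each sent to at most [B]
    edges, and two end segments are added. The sum serves both directions, and the summand 1 makes
    [k] at least 1. *)
Let k : R := 1 + (2 * B%:R / alpha + 2 * B%:R / alpha').
Let c : R := 2 * B%:R + 2.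

Let alpha_gt0 : 0 < alpha. Proof. by case: fatK. Qed.
Let alpha'_gt0 : 0 < alpha'. Proof. by case: fatK'. Qed.
Let ratio_ge0 : 0 <= 2 * B%:R / alpha :> R.
Proof. by rewrite divr_ge0 ?mulr_ge0 ?ler0n // ltW. Qed.
Let ratio'_ge0 : 0 <= 2 * B%:R / alpha' :> R.
Proof. by rewrite divr_ge0 ?mulr_ge0 ?ler0n // ltW. Qed.
Let k_ge1 : 1 <= k.
Proof. by rewrite lerDl addr_ge0. Qed.
Let k_gt0 : 0 < k. Proof. exact: lt_le_trans k_ge1. Qed.
Let c_ge0 : 0 <= c.
Proof. by rewrite addr_ge0 ?mulr_ge0 ?ler0n. Qed.

Let steps_bound (a l m : R) n : 0 < a -> 0 <= l ->
  2 * B%:R / a <= k -> 0 <= m ->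
  n%:R * a <= 2 * l + 2 * a - m -> (n * B)%:R + 2 <= k * l + c.
Proof.
move=> a0 l0 ak m0 na.
have n_le : n%:R <= 2 / a * l + 2.
  have -> : 2 / a * l + 2 = (2 * l + 2 * a) / a by field; rewrite gt_eqF.
  by rewrite ler_pdivlMr //; lra.
have := ler_wpM2r (ler0n R B) n_le; rewrite natrM.
have := ler_wpM2r l0 ak.
rewrite (_ : 2 * B%:R / a * l = 2 / a * l * B%:R); last by ring.
by rewrite /c mulrDl; lra.
Qed.

Let upper x y x' y' v w : realization R K x -> realization R K y ->
  realization R K' x' -> realization R K' y' ->
  x v != 0 -> y w != 0 -> x' (f v) != 0 -> y' (f w) != 0 ->
  forall l, polygon K x y l -> exists2 l', polygon K' x' y' l' & l' <= k * l + c.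
Proof.
move=> Kx Ky Kx' Ky' xv yw xv' yw' l pxy.
have [n vw nl] := polygon_reach fatK pxy xv yw.
have [l' ll' p'] := polygon_joined (map_reach f_adj vw) Kx' Ky' xv' yw'.
exists l' => //; apply: le_trans ll' _.
apply: steps_bound alpha_gt0 _ _ _ nl; rewrite ?(polygon_ge0 pxy) //.
  by rewrite /k; have := ratio'_ge0; lra.
by rewrite le_min (ltW alpha_gt0) andbT; case: Kx.
Qed.

Let lower x y x' y' v w : realization R K x -> realization R K y ->
  realization R K' x' -> realization R K' y' ->
  x v != 0 -> y w != 0 -> x' (f v) != 0 -> y' (f w) != 0 ->
  forall l, polygon K' x' y' l -> exists2 l', polygon K x y l' & l' <= k * l + c.
Proof.
move=> Kx Ky Kx' Ky' xv yw xv' yw' l pxy.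
have [n vw nl] := polygon_reach fatK' pxy xv' yw'.
have := map_reach g_adj vw; rewrite !gfK => vw'.
have [l' ll' p'] := polygon_joined vw' Kx Ky xv yw.
exists l' => //; apply: le_trans ll' _.
apply: steps_bound alpha'_gt0 _ _ _ nl; rewrite ?(polygon_ge0 pxy) //.
  by rewrite /k; have := ratio_ge0; lra.
by rewrite le_min (ltW alpha'_gt0) andbT; case: Kx'.
Qed.

Let length_dist_qi x y x' y' v w : realization R K x -> realization R K y ->
  realization R K' x' -> realization R K' y' ->
  x v != 0 -> y w != 0 -> x' (f v) != 0 -> y' (f w) != 0 ->
  ((k^-1)%:E * length_dist R K x y - c%:E <= length_dist R K' x' y'
     <= k%:E * length_dist R K x y + c%:E)%E.
Proof.
move=> Kx Ky Kx' Ky' xv yw xv' yw'; apply/andP; split.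
  rewrite [leRHS]length_distE; apply/ereal_infP => _ [l p' <-].
  have [l' p ll'] := lower Kx Ky Kx' Ky' xv yw xv' yw' p'.
  rewrite leeBlDr // lee_pdivrMl // length_distE.
  apply: ge_ereal_inf; exists l'%:E; first by exists l'.
  (* As [k] is at least 1, [c] is at most [k * c]. *)
  rewrite -EFinD -EFinM lee_fin (le_trans ll') // mulrDr lerD2l.
  by rewrite ler_peMl.
rewrite -leeBlDr // -lee_pdivrMl // [leRHS]length_distE.
apply/ereal_infP => _ [l p <-].
have [l' p' ll'] := upper Kx Ky Kx' Ky' xv yw xv' yw' p.
rewrite lee_pdivrMl // leeBlDr // length_distE.
apply: ge_ereal_inf; exists l'%:E; first by exists l'.
by rewrite -EFinM -EFinD lee_fin.
Qed.

Let dense u v' y : realization R K' y -> y v' != 0 -> u = f (g v') ->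
  (length_dist R K' (vertex_point R u) y <= c%:E)%E.
Proof.
move=> Ky yv' ->; have Kv' := vertices_support Ky yv'.
have Ku := f_vertex (g_vertex Kv').
have [|l lB p] := polygon_joined (fgK Kv') (realization_vertex R Ku) Ky _ yv'.
  by rewrite vertex_pointE.
rewrite length_distE; apply: ge_ereal_inf; exists l%:E; first by exists l.
by rewrite lee_fin (le_trans lB) // /c; have := ler0n R B; lra.
Qed.

Lemma vertices_quasi_isometry :
  quasi_isometry (vertices K) (vertex_dist R K) (vertices K') (vertex_dist R K') f.
Proof.
split=> //; exists k, c; split=> //.
  move=> v w Kv Kw; apply: (length_dist_qi (v := v) (w := w));
    rewrite ?vertex_pointE //; by apply: realization_vertex; auto.
move=> v Kv; exists (g v); first exact: g_vertex.
apply: (dense (v' := v)) => //; first exact: realization_vertex.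
by rewrite vertex_pointE.
Qed.

Lemma realization_quasi_isometric :
  quasi_isometric (realization R K) (length_dist R K)
                  (realization R K') (length_dist R K').
Proof.
(* If [K] has no vertex, neither has [K'], by [g_vertex]; both realizations are empty and any
   function will do. *)
have [[v0 _]|noV] := pselect (exists v, vertices K v); last first.
  have noK x : ~ realization R K x.
    move=> Kx; have [v xv] := realization_support Kx.
    by case: noV; exists v; exact: vertices_support xv.
  exists (fun _ _ => 0); split=> [x /noK //|].
  exists 1, 0; split=> // [x y /noK //|x Kx].
  have [v xv] := realization_support Kx; case: noV; exists (g v).
  exact: g_vertex (vertices_support Kx xv).
(* Each point is first moved to a vertex of its support; [v0] is only a default outside the
   realization. *)
pose pick (x : V -> R) := xget v0 (vertex_support x).
have pickP x : realization R K x -> x (pick x) != 0.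
  by move=> /realization_support/(xgetPex v0).
have Kpick x : realization R K x -> vertices K (pick x).
  by move=> Kx; apply: vertices_support Kx (pickP x Kx).
exists (fun x => vertex_point R (f (pick x))); split.
  by move=> x Kx; apply/realization_vertex/f_vertex/Kpick.
exists k, c; split=> // [x y Kx Ky|y Ky].
  apply: (length_dist_qi (v := pick x) (w := pick y));
    rewrite ?vertex_pointE ?pickP //; by apply/realization_vertex/f_vertex/Kpick.
have [v yv] := realization_support Ky.
have Kg := g_vertex (vertices_support Ky yv).
exists (vertex_point R (g v)); first exact: realization_vertex.
apply: (dense Ky yv); congr f; apply/eqP.
by have := pickP _ (realization_vertex R Kg); rewrite vertex_pointE.
Qed.

End SkeletonQuasiIsometry.

(** * The coned off Deligne complex *)

(** A finite chain has a least member, all of whose elements are common to the chain. *)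
Lemma finite_chain_meet (T : Type) (s : set (set T)) :
  finite_set s -> (forall C, s C -> C !=set0)%classic -> s !=set0%classic ->
  (forall C D, s C -> s D -> C `<=` D \/ D `<=` C)%classic ->
  exists x, forall C, s C -> C x.
Proof.
move=> /finite_seqP[r ->] ne s0 chain_r.
suff [C rC Cmin] : exists2 C, C \in r & forall D, D \in r -> (C `<=` D)%classic.
  by have [x Cx] := ne _ rC; exists x => D rD; exact: Cmin Cx.
have {s0} : r != [::] by case: s0 => C; case: (r).
elim: r chain_r {ne} => // C [|D r] IHr chain_r _.
  by exists C; rewrite ?mem_head // => D; rewrite inE => /eqP ->.
have [|//|E rE Emin] := IHr.
  by move=> C' D' rC' rD'; apply: chain_r; rewrite /= in_cons ?rC' ?rD' orbT.
have [||CE|EC] := chain_r C E; rewrite /= ?mem_head //.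
- by rewrite in_cons rE orbT.
- exists C; rewrite ?mem_head // => F; rewrite in_cons => /orP[/eqP -> //|rF].
  by apply: subset_trans CE _; exact: Emin.
- exists E; first by rewrite in_cons rE orbT.
  by move=> F; rewrite in_cons => /orP[/eqP -> //|rF]; exact: Emin.
Qed.

Section ConedDeligne.
Local Open Scope group_scope.
Local Open Scope classical_set_scope.
Variables (R : realType) (Gamma : labelled_graph).
Local Notation X := (vertex Gamma).
Local Notation A := (artin_group Gamma).
Local Notation M := (@artin_monoid Gamma).
Local Notation Cay := (monoid_cayley Gamma).
Local Notation CD := (coned_deligne Gamma).
Implicit Types (g h m n : A) (T : {set X}) (C : set A).

Lemma left_cosetM g h C : left_coset g (left_coset h C) = left_coset (g * h) C.
Proof.
apply/seteqP; split=> [_ [_ [a Ca <-] <-]|_ [a Ca <-]].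
  by exists a; rewrite // mulgA.
by exists (h * a); [exists a|rewrite mulgA].
Qed.

Lemma left_coset_refl g T : left_coset g (special_subgroup T) g.
Proof. by have [H1 _ _] := special_is_subgroup T; exists 1; rewrite ?mulg1. Qed.

Lemma left_coset_eq g h T : left_coset g (special_subgroup T) h ->
  left_coset g (special_subgroup T) = left_coset h (special_subgroup T).
Proof.
have [_ HM HV] := special_is_subgroup T; move=> [a Ta <-]; rewrite -left_cosetM.
congr left_coset; apply/seteqP; split=> [b Tb|_ [b Tb <-]]; last exact: HM.
by exists (a^-1 * b); [apply: HM => //; exact: HV|rewrite mulVKg].
Qed.

Lemma cayley_adjacent g m : M m -> adjacent Cay g (g * m).
Proof.
move=> Mm; exists [set g; g * m]; split; [right|by left|by right].
by exists g, (g * m); split=> //; exists m => //; left.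
Qed.

Lemma cayley_adjacentP g h : adjacent Cay g h ->
  exists2 m, M m & h = g * m \/ g = h * m.
Proof.
move=> [s [[[v ->]|[v [w [[m Mm vw] ->]]]]]] /=.
  by move=> -> ->; exists 1; [exact: artin_monoid1|left; rewrite mulg1].
move=> [->|->] [->|->]; try by exists m.
- by exists 1; [exact: artin_monoid1|left; rewrite mulg1].
- by exists m => //; case: vw => ->; [right|left].
- by exists 1; [exact: artin_monoid1|left; rewrite mulg1].
Qed.

(** Write g' = g m n^-1: the path goes forward along m to g m, then backward along n. *)
Lemma coset_joined h T g g' : spherical_type (full_subgraph T) ->
  left_coset h (special_subgroup T) g -> left_coset h (special_subgroup T) g' ->
  joined Cay 2 g g'.
Proof.
move=> Tsph /left_coset_eq -> [a Ta <-].
have [m [n [Mm Mn ->]]] := spherical_fraction R Tsph Ta.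
apply: (joined_cat (m := 1) (n := 1) (v := g * m)).
  exact/joined_adjacent/cayley_adjacent.
apply/joined_adjacent/adjacent_sym; rewrite -[X in adjacent _ _ X](mulgVK n).
by rewrite mulgA; exact: cayley_adjacent.
Qed.

Lemma cone_adjacent g m T : M m -> spherical_type (full_subgraph T) ->
  adjacent CD (inr g) (inl (left_coset (g * m) (special_subgroup T))).
Proof.
move=> Mm Tsph; set C := left_coset (g * m) _.
exists (inr g |` inl @` [set C]); split; last by right; exists C.
  constructor 3; exists g, [set C] => //.
  exists [set left_coset m (special_subgroup T)]; last first.
    by rewrite image_set1 left_cosetM.
  split; first exact: finite_set1.
  - by exists (left_coset m (special_subgroup T)).
  - by move=> _ ->; exists m, T.
  - by move=> _ _ -> ->; left.
by left.
Qed.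

Lemma translate_simplex g s C : simplices (monoid_deligne_translate g) s -> s C ->
  exists m T, [/\ M m, spherical_type (full_subgraph T)
                & C = left_coset (g * m) (special_subgroup T)].
Proof.
move=> [s' [_ _ s'M _] <-] [D /s'M[m [T [Mm Tsph ->]]] <-].
by exists m, T; rewrite left_cosetM.
Qed.

Definition cone_base (u : set A + A) : A :=
  match u with inl C => xget 1 C | inr g => g end.

Lemma cone_base_coset g T :
  let C := left_coset g (special_subgroup T) in C (cone_base (inl C)).
Proof. by apply: xgetPex; exists g; exact: left_coset_refl. Qed.

(** Of two nested cosets, the larger contains both chosen elements. *)
Lemma deligne_adjacent s C D : simplices (deligne Gamma) s -> s C -> s D ->
  joined Cay 2 (cone_base (inl C)) (cone_base (inl D)).
Proof.
move=> [_ _ sP s_chain] sC sD.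
have [[g [T [_ Tsph CE]]] [h [S [_ Ssph DE]]]] := (sP _ sC, sP _ sD).
have := s_chain _ _ sC sD; rewrite CE DE => -[CD|DC].
  by apply: (coset_joined Ssph); [apply: CD|]; exact: cone_base_coset.
by apply: (coset_joined Tsph); [|apply: DC]; exact: cone_base_coset.
Qed.

(** The chosen element is g m p q^-1 with p and q in [M]. Since m p is in [M], a single edge leads
    from g to g m p, and a second one goes back along q. *)
Lemma cone_adjacent_base g m T : M m -> spherical_type (full_subgraph T) ->
  joined Cay 2 g (cone_base (inl (left_coset (g * m) (special_subgroup T)))).
Proof.
move=> Mm Tsph; have [a Ta <-] := cone_base_coset (g * m) T.
have [p [q [Mp Mq ->]]] := spherical_fraction R Tsph Ta.
apply: (joined_cat (m := 1) (n := 1) (v := g * (m * p))).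
  exact/joined_adjacent/cayley_adjacent/artin_monoidM.
apply/joined_adjacent/adjacent_sym.
rewrite -[X in adjacent _ _ X](mulgVK q) !mulgA.
exact: cayley_adjacent.
Qed.

Lemma cone_base_adjacent u v : adjacent CD u v ->
  joined Cay 2 (cone_base u) (cone_base v).
Proof.
move=> [s [[[s' Ds' ->]|[g ->]|[g [s' Ls' ->]]]]].
- by move=> [C s'C <-] [D s'D <-]; exact: deligne_adjacent Ds' _ _.
- by move=> -> ->; exact: joined_refl.
- have to_base C : s' C -> joined Cay 2 g (cone_base (inl C)).
    by move=> /(translate_simplex Ls')[m [T [? ? ->]]]; exact: cone_adjacent_base.
  move=> [->|[C s'C <-]] [->|[D s'D <-]].
  + exact: joined_refl.
  + exact: to_base.
  + exact/joined_sym/to_base.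
  + apply: deligne_adjacent s'C s'D; exact: monoid_deligne_translate_sub Ls'.
Qed.

Lemma cone_vertex_adjacent g h : adjacent Cay g h ->
  joined CD 2 (cone_vertex g) (cone_vertex h).
Proof.
wlog [m Mm ->] : g h / exists2 m, M m & h = g * m.
  move=> wl gh; have [m Mm [hE|gE]] := cayley_adjacentP gh.
    by apply: wl => //; exists m.
  by apply/joined_sym/wl; [exists m|exact: adjacent_sym].
move=> _; have sph0 := spherical_empty Gamma.
apply: (joined_cat (m := 1) (n := 1)); apply: joined_adjacent.
  exact: cone_adjacent Mm sph0.
apply: adjacent_sym; rewrite -[X in inl (left_coset X _)]mulg1.
exact: cone_adjacent (artin_monoid1 _) sph0.
Qed.

Lemma cone_vertexK g : cone_base (cone_vertex g) = g.
Proof. by []. Qed.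

(** A coset C with chosen element b equals b A_T, so it lies in the translate by b of the monoid
    Deligne complex and is joined to v_b. *)
Lemma cone_base_joined u : vertices CD u -> joined CD 2 (cone_vertex (cone_base u)) u.
Proof.
case: u => [C Cv|g _]; last exact: joined_refl.
have [s' Ds' s'C] : exists2 s', simplices (deligne Gamma) s' & s' C.
  have : [set inl C] (inl C : set A + A) by [].
  case: Cv => [[s' Ds' ->] [D s'D [<-]]|[g ->] //|[g [s' Ls' ->]] [//|[D s'D [<-]]]].
    by exists s'.
  by exists s' => //; exact: monoid_deligne_translate_sub Ls'.
have [_ _ /(_ _ s'C)[g [T [_ Tsph CE]]] _] := Ds'.
have /left_coset_eq Cb := cone_base_coset g T; rewrite -CE in Cb.
exists 1%N => //; exists (inl C) => //; rewrite {2}Cb.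
rewrite -[X in inl (left_coset X _)]mulg1.
exact: cone_adjacent (artin_monoid1 _) Tsph.
Qed.

Lemma cayley_fat : fat Cay (3%:R^-1 : R).
Proof.
apply: (@bounded_fat _ _ _ 2) => s [[v ->]|[v [w [_ ->]]]].
  by exists [:: v] => // _ ->; rewrite /= mem_head.
by exists [:: v; w] => // _ [->|->]; rewrite /= !inE eqxx ?orbT.
Qed.

(** All cosets of a chain share an element g, hence have the form g A_T, with one candidate for each
    set [T] of vertices. *)
Lemma deligne_chain_bounded s : simplices (deligne Gamma) s ->
  exists2 r : seq (set A), (size r <= #|{set X}|)%N & s `<=` [set` r].
Proof.
move=> [s_fin s_ne sP s_chain].
have [|g sg] := finite_chain_meet s_fin _ s_ne s_chain.
  by move=> C /sP[h [T [_ _ ->]]]; exists h; exact: left_coset_refl.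
exists [seq left_coset g (special_subgroup T) | T <- enum {set X}].
  by rewrite size_map -cardE.
move=> C sC; have [h [T [_ _ CE]]] := sP _ sC.
apply/mapP; exists T; first by rewrite mem_enum.
by rewrite CE; apply: left_coset_eq; rewrite -CE; exact: sg.
Qed.

Lemma coned_deligne_fat : fat CD (#|{set X}|.+2%:R^-1 : R).
Proof.
(* The additional vertex is the cone point. *)
apply: (@bounded_fat _ _ _ #|{set X}|.+1).
move=> s [[s' Ds' ->]|[g ->]|[g [s' Ls' ->]]].
- have [r szr sr] := deligne_chain_bounded Ds'.
  exists [seq inl C | C <- r]; first by rewrite size_map leqW.
  by move=> _ [C s'C <-] /=; rewrite map_f //; exact: sr.
- by exists [:: inr g] => // _ ->; rewrite /= mem_head.
- have [r szr sr] := deligne_chain_bounded (monoid_deligne_translate_sub Ls').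
  exists (inr g :: [seq inl C | C <- r]); first by rewrite /= size_map.
  move=> _ [->|[C s'C <-]] /=; first exact: mem_head.
  by rewrite in_cons map_f ?orbT //; exact: sr.
Qed.

End ConedDeligne.

Theorem theorem3p2 (R : realType) (Gamma : labelled_graph) :
  infinite_type Gamma ->
  quasi_isometry
    (vertices (monoid_cayley Gamma)) (vertex_dist R (monoid_cayley Gamma))
    (vertices (coned_deligne Gamma)) (vertex_dist R (coned_deligne Gamma))
    (@cone_vertex Gamma) /\
  quasi_isometric
    (realization R (monoid_cayley Gamma)) (length_dist R (monoid_cayley Gamma))
    (realization R (coned_deligne Gamma)) (length_dist R (coned_deligne Gamma)).
Proof.
move=> _.
have f_vertex g : vertices (monoid_cayley Gamma) g ->
    vertices (coned_deligne Gamma) (cone_vertex g) by constructor 2; exists g.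
have g_vertex u : vertices (coned_deligne Gamma) u ->
    vertices (monoid_cayley Gamma) (cone_base u) by left; exists (cone_base u).
split.
  exact: (vertices_quasi_isometry (cayley_fat R Gamma) (coned_deligne_fat R Gamma)
    f_vertex g_vertex (@cone_vertex_adjacent Gamma) (@cone_base_adjacent R Gamma)
    (@cone_vertexK Gamma) (@cone_base_joined Gamma)).
exact: (realization_quasi_isometric (cayley_fat R Gamma) (coned_deligne_fat R Gamma)
    f_vertex g_vertex (@cone_vertex_adjacent Gamma) (@cone_base_adjacent R Gamma)
    (@cone_vertexK Gamma) (@cone_base_joined Gamma)).
Qed.
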